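(* Let $0<p<1$, let $\{X_n,\ n\ge1\}$ be the steps of the elephant random walk that remembers only the first two steps, with $P(X_1=1)=p=1-P(X_1=-1)$, and let $S_n=\sum_{k=1}^n X_k$. Then: (a) as $n\to\infty$, $\dfrac{S_n-n(2p-1)(X_1+X_2)/2}{\sqrt n}$ converges in distribution to the mixture $p\cdot\mathcal N_{0,4p(1-p)}+(1-p)\cdot\mathcal N_{0,1}$; (b) $\dfrac{S_n-n(2p-1)(X_1+X_2)/2}{n}\to0$ almost surely as $n\to\infty$; (c) almost surely, $$\limsup_{n\to\infty}\frac{S_n-n(2p-1)(X_1+X_2)/2}{\sqrt{2n\log\log n}}=\sigma(X_1,X_2)\quad\text{and}\quad\liminf_{n\to\infty}\frac{S_n-n(2p-1)(X_1+X_2)/2}{\sqrt{2n\log\log n}}=-\sigma(X_1,X_2),$$ where $\sigma(X_1,X_2)=\sqrt{4p(1-p)}$ on the event $\{X_1X_2=1\}$ and $\sigma(X_1,X_2)=1$ otherwise.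
   Context: Elephant random walk remembering only the first two steps: $X_2=X_1$ with probability $p$ and $X_2=-X_1$ with probability $1-p$; for every $n\ge2$, choose $K$ with $P(K=1)=P(K=2)=1/2$ and set $X_{n+1}=X_K$ with probability $p$ and $X_{n+1}=-X_K$ with probability $1-p$. All index choices and sign choices are mutually independent and independent of $X_1$. $\mathcal N_{0,\sigma^2}$ denotes the distribution function of the normal law with mean $0$ and variance $\sigma^2$; a convex combination of such distribution functions denotes the corresponding mixture distribution. *)

(* Defs.v *)
From HB Require Import structures.
From mathcomp Require Import all_boot all_order all_algebra finmap.
From mathcomp Require Import all_classical all_reals all_analysis.
From mathcomp Require Import measurable_realfun.

Set Implicit Arguments.
Unset Strict Implicit.
Unset Printing Implicit Defensive.

Import Order.TTheory GRing.Theory Num.Theory.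
Import numFieldNormedType.Exports.

Local Open Scope classical_set_scope.
Local Open Scope ring_scope.

Definition mutual_independence d (T : measurableType d) (R : realType)
    (P : probability T R) (I : choiceType) (F : I -> set (set T)) : Prop :=
  (forall i, F i `<=` measurable) /\
  forall (J : {fset I}) (E : I -> set T), (forall i, i \in J -> F i (E i)) ->
    P (\bigcap_(i in [set` J]) E i) = (\prod_(i <- J) P (E i))%E.

Definition cvg_in_distribution d (T : measurableType d) (R : realType)
    (P : probability T R) (Y : nat -> {RV P >-> R}) (F : R -> \bar R) : Prop :=
  forall x : R, {for x, continuous F} -> cdf (Y n) x @[n --> \oo] --> F x.

(* normal_prob takes the standard deviation; v is the variance. *)
Definition normal_cdf (R : realType) (v : R) (x : R) : \bar R :=
  normal_prob 0 (Num.sqrt v) `]-oo, x].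

(* X n is the n-th step for n >= 1; X 0 plays no role.  For the step X n.+1,
   the event [B n = true] means that the sign of the recalled step is kept,
   and K n (for n >= 2) is the index of the recalled step.  In the independent
   family, None stands for X 1, Some (inl n) for the sign choice B n.+1 and
   Some (inr n) for the index choice K n.+2, so that exactly the choices that
   are used are listed. *)
Definition elephant_walk_first_two d (T : measurableType d) (R : realType)
    (P : probability T R) (p : R) (X : nat -> {RV P >-> R}) : Prop :=
  exists (B : nat -> {RV P >-> bool}) (K : nat -> {RV P >-> nat}),
  [/\ forall n, (1 <= n)%N ->
        P [set w | B n w = true] = p%:E /\
        P [set w | B n w = false] = (1 - p)%:E,
      forall n, (2 <= n)%N ->
        P [set w | K n w = 1%N] = (2^-1)%:E /\
        P [set w | K n w = 2%N] = (2^-1)%:E,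
      mutual_independence P (fun i : option (nat + nat) =>
        match i with
        | None => g_sigma_algebra_preimage (X 1%N)
        | Some (inl n) => g_sigma_algebra_preimage (B n.+1)
        | Some (inr n) => g_sigma_algebra_preimage (K n.+2)
        end),
      {ae P, forall w, X 2 w = if B 1%N w then X 1%N w else - X 1%N w} &
      forall n, (2 <= n)%N ->
        {ae P, forall w,
          X n.+1 w = if B n w then X (K n w) w else - X (K n w) w}].

Section centered_position.
Context d (T : measurableType d) (R : realType) (P : probability T R).
Variables (p : R) (X : nat -> {RV P >-> R}).

Definition position (n : nat) (w : T) : R := \sum_(1 <= k < n.+1) X k w.

Definition centered_position (n : nat) (w : T) : R :=
  position n w - n%:R * (2 * p - 1) * (X 1%N w + X 2 w) / 2.

Lemma measurable_centered_position n :
  measurable_fun [set: T] (centered_position n).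
Proof.
apply: measurable_funB.
  by apply: measurable_sum => k; exact: measurable_funPT.
apply: measurable_funM => //; apply: measurable_funM => //.
by apply: measurable_funD; exact: measurable_funPT.
Qed.

HB.instance Definition _ n := isMeasurableFun.Build _ _ _ _
  (centered_position n) (measurable_centered_position n).

End centered_position.

Definition limit_deviation d (T : measurableType d) (R : realType)
    (P : probability T R) (p : R) (X : nat -> {RV P >-> R}) (w : T) : R :=
  if X 1%N w * X 2 w == 1 then Num.sqrt (4 * p * (1 - p)) else 1.

(* Main.v *)
Require Import Defs.
From HB Require Import structures.
From mathcomp Require Import all_boot all_order all_algebra finmap.
From mathcomp Require Import all_classical all_reals all_analysis.
From mathcomp Require Import measurable_realfun ring lra.

Set Implicit Arguments.
Unset Strict Implicit.
Unset Printing Implicit Defensive.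

Import Order.TTheory GRing.Theory Num.Theory.
Import numFieldNormedType.Exports.

Local Open Scope classical_set_scope.
Local Open Scope ring_scope.

(* Put x = X_1. On {X_1 X_2 = 1} every later step is x times the sign choice, and
   on {X_1 X_2 = -1} it is x times the product of the sign choice and of the sign
   that tells whether step 1 or 2 is recalled. So, up to a bounded error, the
   centred position is 2x times a walk S_n with i.i.d. steps b - q, where b is
   Bernoulli q, and q = p or q = 1/2; moreover the walk is independent of
   (X_1, X_2). It remains to prove the central limit theorem and the law of the
   iterated logarithm for S_n; with v = q(1-q), the three estimates below are all
   inductions on n that condition on the first step.

   - Central limit theorem: P(S_n <= x) and Phi(x / sqrt(v(m+n))) satisfy the same
     recursion up to an error O((m+n)^(-3/2)), by the heat equation. Up to a shift
     of x they are close at n = 0, hence they stay close for all n if m is large.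

   - Upper half of the iterated logarithm: P(max_{k<=n} S_k >= x) is at most
     exp(-tx) E[exp(tb - tq)]^n. This is applied with n about rho^k, rho > 1, and
     summed over k (Borel-Cantelli).

   - Lower half: exponential tilting and Chebyshev's inequality, packed in a single
     pointwise bound, give P(S_n >= (1-o(1)) sqrt(2vnL)) >= c exp(-L). This is
     applied to the independent blocks between B^(2k) and B^(2k+2), with
     L = log((2k+2) log B), so that the probabilities sum to infinity.

   The strong law follows from the iterated logarithm. *)

(** * Bernoulli words and exponential estimates *)

Section bernoulli_words.
Context (R : realType) (q : R).
Hypothesis q01 : 0 < q < 1.
Let q0 : 0 < q. Proof. by case/andP: q01. Qed.
Let q1 : 0 < 1 - q. Proof. by rewrite subr_gt0; case/andP: q01. Qed.

(* The probability of [Q] for a word of [n] independent Bernoulli [q] bits. *)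
Fixpoint bern (n : nat) (Q : pred (seq bool)) : R :=
  if n is n'.+1 then
    q * bern n' (fun s => Q (true :: s)) + (1 - q) * bern n' (fun s => Q (false :: s))
  else (Q [::])%:R.

Lemma bernS n Q : bern n.+1 Q =
  q * bern n (fun s => Q (true :: s)) + (1 - q) * bern n (fun s => Q (false :: s)).
Proof. by []. Qed.

Lemma le_bern n (Q Q' : pred (seq bool)) :
  (forall s, size s = n -> Q s -> Q' s) -> bern n Q <= bern n Q'.
Proof.
elim: n Q Q' => [|n IH] Q Q' QQ' /=.
  by have := QQ' [::] erefl; case: (Q [::]) => // /(_ isT) ->.
by apply: lerD; rewrite ler_pM2l//; apply: IH => s sn; apply: QQ'; rewrite /= sn.
Qed.

Lemma eq_bern n (Q Q' : pred (seq bool)) :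
  (forall s, size s = n -> Q s = Q' s) -> bern n Q = bern n Q'.
Proof. by move=> QQ'; apply/le_anti/andP; split; apply: le_bern => s /QQ' ->. Qed.

Lemma bern_xpredT n : bern n xpredT = 1.
Proof. by elim: n => //= n ->; rewrite !mulr1 addrC subrK. Qed.

Lemma bern_ge0 n Q : 0 <= bern n Q.
Proof.
by elim: n Q => [|n IH] Q /=; rewrite ?ler0n// addr_ge0// mulr_ge0// ltW.
Qed.

Lemma bern_predC n Q : bern n (fun s => ~~ Q s) = 1 - bern n Q.
Proof.
elim: n Q => [|n IH] Q /=; first by case: (Q _); rewrite /= ?subrr ?subr0.
by rewrite !IH; ring.
Qed.

Lemma bern_pred0 n : bern n xpred0 = 0.
Proof. by elim: n => //= n ->; rewrite !mulr0 addr0. Qed.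

Lemma bern_const n (b : bool) (Q : pred (seq bool)) :
  bern n (fun s => b && Q s) = b%:R * bern n Q.
Proof.
by case: b; rewrite ?mul1r// mul0r; exact: bern_pred0.
Qed.

(** Independence of consecutive blocks of bits; it turns the probability of repeated failure into a
    product in [block_borel_cantelli]. *)
Lemma bern_cat m n (Q Q' : pred (seq bool)) :
  bern (m + n) (fun s => Q (take m s) && Q' (drop m s)) = bern m Q * bern n Q'.
Proof.
elim: m Q => [|m IH] Q /=.
  rewrite add0n -bern_const; apply: eq_bern => s _.
  by rewrite take0 drop0.
by rewrite (IH (fun s => Q (true :: s))) (IH (fun s => Q (false :: s))); ring.
Qed.

Definition walk (s : seq bool) : R := \sum_(b <- s) (b%:R - q).

Lemma walk_cons b s : walk (b :: s) = b%:R - q + walk s.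
Proof. by rewrite /walk big_cons. Qed.

Lemma walk_nil : walk [::] = 0. Proof. by rewrite /walk big_nil. Qed.

(** The event that the running maximum of the walk, time 0 included, reaches [x]. Lowering the
    target along the word, instead of storing the maximum, fits inductions on the first bit. *)
Fixpoint hit (x : R) (s : seq bool) : bool :=
  (x <= 0) || (if s is b :: s' then hit (x - (b%:R - q)) s' else false).

Lemma hit_walk x s k : x <= walk (take k s) -> hit x s.
Proof.
elim: s x k => [|b s IH] x k /=; first by rewrite walk_nil => ->.
case: k => [|k]; first by rewrite walk_nil => ->.
by rewrite walk_cons -lerBlDl => /IH ->; rewrite orbT.
Qed.

(** Moment generating function of one centred step [b - q]. *)
Definition mgf (t : R) : R := q * expR (t * (1 - q)) + (1 - q) * expR (- (t * q)).

Lemma mgf_gt0 t : 0 < mgf t.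
Proof. by rewrite addr_gt0// mulr_gt0// expR_gt0. Qed.

Lemma mgf_ge1 t : 1 <= mgf t.
Proof.
move: q01 => /andP[? ?].
have h1 : q * (1 + t * (1 - q)) <= q * expR (t * (1 - q)).
  by rewrite ler_pM2l// expR_ge1Dx.
have h2 : (1 - q) * (1 - t * q) <= (1 - q) * expR (- (t * q)).
  by rewrite ler_pM2l//; exact: expR_ge1Dx.
rewrite /mgf; apply: le_trans (lerD h1 h2); lra.
Qed.

(* Kolmogorov's exponential maximal inequality, by conditioning on the first bit. *)
Lemma bern_hit n t x : 0 <= t ->
  bern n (hit x) <= expR (- (t * x)) * mgf t ^+ n.
Proof.
move=> t0; elim: n x => [|n IH] x /=.
  rewrite orbF expr0 mulr1; case: (leP x 0) => x0; rewrite ?expR_ge0//.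
  by rewrite -expR0 ler_expR oppr_ge0 mulr_ge0_le0.
case: (leP x 0) => x0 /=.
  rewrite bern_xpredT !mulr1 addrC subrK.
  apply: (@le_trans _ _ (1 * 1)); first by rewrite mulr1.
  apply: ler_pM => //; last by rewrite exprn_ege1// mgf_ge1.
  by rewrite -[leLHS]expR0 ler_expR oppr_ge0 mulr_ge0_le0.
rewrite exprS mulrCA mulrA.
(* The right-hand side of the bound satisfies the first-bit recursion of [bern] exactly. *)
have -> : mgf t * expR (- (t * x)) * mgf t ^+ n =
   q * (expR (- (t * (x - (1 - q)))) * mgf t ^+ n)
   + (1 - q) * (expR (- (t * (x - (0 - q)))) * mgf t ^+ n).
  rewrite !mulrA -mulrDl; congr (_ * _); rewrite /mgf mulrDl -!mulrA -!expRD.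
  by congr (_ * expR _ + _ * expR _); ring.
by apply: lerD; rewrite ler_pM2l// IH.
Qed.

(** Success probability of a bit under the law reweighted by [expR (t * walk)]; [drift] is the mean
    of a centred step under that law. *)
Definition tilt (t : R) : R := q * expR (t * (1 - q)) / mgf t.
Definition drift (t : R) : R := tilt t - q.

Lemma tilt1 t : 1 - tilt t = (1 - q) * expR (- (t * q)) / mgf t.
Proof.
rewrite /tilt -[X in X - _](divff (lt0r_neq0 (mgf_gt0 t))) -mulrBl.
by congr (_ / _); rewrite /mgf; ring.
Qed.

(* The pointwise bound [1_{S >= 0} >= e^{t(S - 2w)}(1 - (S - w)^2/w^2)] is
   integrated under the tilted law, whose steps have mean [drift t] and
   variance at most [1/4]. *)
Lemma bern_lower n t w x : 0 <= t -> 0 < w ->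
  mgf t ^+ n * expR (t * (x - w *+ 2)) *
    (1 - ((x - w + n%:R * drift t) ^+ 2 + n%:R / 4) / w ^+ 2)
  <= bern n (fun s => 0 <= x + walk s).
Proof.
move=> t0 w0; have w20 : 0 < w ^+ 2 by rewrite exprn_gt0.
elim: n x => [|n IH] x /=.
  rewrite walk_nil addr0 expr0 mul1r !mul0r !addr0.
  (* Base case: the quadratic factor is nonpositive off [[0, 2w]], and on this interval both factors
     are at most 1. *)
  case: (leP 0 x) => x0; last first.
    apply: mulr_ge0_le0; rewrite ?expR_ge0// subr_le0 ler_pdivlMr// mul1r.
    rewrite -subr_ge0; have -> : (x - w) ^+ 2 - w ^+ 2 = (- x) * (w *+ 2 - x) by ring.
    apply: mulr_ge0; first by lra.
    by rewrite mulr2n; lra.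
  have [xw|xw] := leP x (w *+ 2).
    rewrite -[leRHS]mulr1; apply: ler_pM; rewrite ?expR_ge0//.
    - rewrite subr_ge0 ler_pdivrMr// mul1r -subr_ge0.
      have -> : w ^+ 2 - (x - w) ^+ 2 = x * (w *+ 2 - x) by ring.
      by apply: mulr_ge0 => //; rewrite subr_ge0.
    - by rewrite -expR0 ler_expR; apply: mulr_ge0_le0 => //; rewrite subr_le0.
    - by rewrite gerBl divr_ge0// ?sqr_ge0// ltW.
  apply: (@le_trans _ _ 0) => //; apply: mulr_ge0_le0; rewrite ?expR_ge0//.
  rewrite subr_le0 ler_pdivlMr// mul1r -subr_ge0.
  have -> : (x - w) ^+ 2 - w ^+ 2 = x * (x - w *+ 2) by ring.
  by apply: mulr_ge0 => //; rewrite subr_ge0 ltW.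
have E b : bern n (fun s => 0 <= x + walk (b :: s)) =
           bern n (fun s => 0 <= x + (b%:R - q) + walk s).
  by apply: eq_bern => s _; rewrite walk_cons addrA.
rewrite !E /= mulr1n mulr0n; apply: le_trans (lerD (ler_wpM2l (ltW q0) (IH _)) (ler_wpM2l (ltW q1) (IH _))).
set y := x - w; set M := mgf t ^+ n; set m := drift t; set r := tilt t.
(* Change of measure: the original weight of a bit times its exponential shift is [mgf t] times its
   tilted weight. *)
have qe : q * expR (t * (x + (1 - q) - w *+ 2)) = mgf t * r * expR (t * (x - w *+ 2)).
  rewrite /r /tilt mulrCA divff ?lt0r_neq0 ?mgf_gt0// mulr1 -mulrA -expRD.
  by congr (_ * expR _); ring.
have qe' : (1 - q) * expR (t * (x + (0 - q) - w *+ 2))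
    = mgf t * (1 - r) * expR (t * (x - w *+ 2)).
  rewrite /r tilt1 mulrCA divff ?lt0r_neq0 ?mgf_gt0// mulr1 -mulrA -expRD.
  by congr (_ * expR _); ring.
set e1 := expR (t * (x + (_ - q) - _)) in qe *.
set e2 := expR (t * (x + (0 - q) - _)) in qe' *.
set e := expR (t * (x - _)) in qe qe' *.
set Z1 := 1 - _; set Z2 := 1 - _; set Z3 := 1 - _.
have -> : q * (M * e1 * Z2) + (1 - q) * (M * e2 * Z3) =
  M * mgf t * e * (r * Z2 + (1 - r) * Z3).
  rewrite (_ : q * _ = M * (q * e1) * Z2); last by ring.
  by rewrite (_ : (1 - q) * (_ * _) = M * ((1 - q) * e2) * Z3); [rewrite qe qe'; ring|ring].
rewrite exprSr; apply: ler_wpM2l.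
  by rewrite !mulr_ge0 ?exprn_ge0 ?expR_ge0// ltW// mgf_gt0.
rewrite -subr_ge0.
(* A tilted step has variance [r (1 - r)], and [1/4 - r (1 - r)] is the square [(r - 1/2)^2]. *)
have -> : r * Z2 + (1 - r) * Z3 - Z1 = (r - 2^-1) ^+ 2 / w ^+ 2.
  rewrite /Z1 /Z2 /Z3 /y /m /drift -/r -[n.+1%:R]natr1.
  by field; rewrite gt_eqF.
by rewrite divr_ge0 ?sqr_ge0.
Qed.

End bernoulli_words.

(** * Elementary limits and the mean value theorem *)

Section mean_value.
Context (R : realType).

Lemma natV_cvg0 : (n%:R : R)^-1 @[n --> \oo] --> (0 : R).
Proof.
apply/gtr0_cvgV0; last exact: cvgr_idn.
by near=> n; rewrite ltr0n; near: n; exact: nbhs_infty_gt.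
Unshelve. all: by end_near. Qed.

Lemma sqrt_natV_cvg0 : Num.sqrt (n%:R : R)^-1 @[n --> \oo] --> (0 : R).
Proof. by have := cvg_comp _ _ natV_cvg0 (@sqrt_continuous R 0); rewrite sqrtr0. Qed.

Lemma is_derive1M (f g : R -> R) (x a b : R) :
  is_derive x 1 f a -> is_derive x 1 g b ->
  is_derive x 1 (fun t => f t * g t) (a * g x + f x * b).
Proof.
move=> df dg; apply: (is_derive_eq (is_deriveM df dg)).
by rewrite /GRing.scale/=; ring.
Qed.

Lemma is_derive1D (f g : R -> R) (x a b : R) :
  is_derive x 1 f a -> is_derive x 1 g b ->
  is_derive x 1 (fun t => f t + g t) (a + b).
Proof. by move=> df dg; exact: (is_deriveD df dg). Qed.

Lemma is_derive1_mull (k x : R) : is_derive x 1 (fun t => k * t) k.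
Proof.
have := is_derive1M (is_derive_cst k x 1) (is_derive_id x 1).
by rewrite mul0r add0r mulr1.
Qed.

Lemma mean_value (f df : R -> R) (a b : R) : a <= b ->
  (forall x, a <= x <= b -> is_derive x 1 f (df x)) ->
  exists2 c, a <= c <= b & f b - f a = df c * (b - a).
Proof.
move=> ab dff.
have [||c] := @MVT_segment R f df a b ab.
- by move=> x; rewrite in_itv/= => /andP[ax xb]; apply: dff; rewrite !ltW.
- apply: derivable_within_continuous => x; rewrite in_itv/= => xab.
  by apply: ex_derive; exact: dff.
- by rewrite in_itv/= => cab ->; exists c.
Qed.

Lemma derive_ge0_le (f df : R -> R) (a b : R) : a <= b ->
  (forall x, a <= x <= b -> is_derive x 1 f (df x)) ->
  (forall x, a <= x <= b -> 0 <= df x) -> f a <= f b.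
Proof.
move=> ab dff df0; have [c cab fE] := mean_value ab dff.
by rewrite -subr_ge0 fE mulr_ge0 ?subr_ge0// df0.
Qed.

End mean_value.

(** * Expansion of the log moment generating function and tail bounds *)

Section mgf_bounds.
Context (R : realType) (q : R).
Hypothesis q01 : 0 < q < 1.
Local Notation mgf := (mgf q).
Local Notation drift := (drift q).
Let q0 : 0 < q. Proof. by case/andP: q01. Qed.
Let q1 : 0 < 1 - q. Proof. by rewrite subr_gt0; case/andP: q01. Qed.
Let v := q * (1 - q).
Let v0 : 0 < v. Proof. by rewrite mulr_gt0. Qed.

(** Cancelling the common factor [expR (- (t * q))] leaves a rational function of [expR t], so
    bounds on [expR t] suffice to estimate the drift. *)
Lemma driftE t : drift t = v * (expR t - 1) / (1 - q + q * expR t).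
Proof.
have D0 : 0 < 1 - q + q * expR t by rewrite addr_gt0// mulr_gt0// expR_gt0.
have E : expR (t * (1 - q)) = expR t * expR (- (t * q)).
  by rewrite -expRD; congr expR; ring.
have ME : mgf t = (1 - q + q * expR t) * expR (- (t * q)).
  by rewrite /mgf E; ring.
rewrite /drift /tilt ME E /v; field.
by rewrite !gt_eqF// expR_gt0.
Qed.

(** The tilted mean is the derivative of the cumulant generating function, so that bounds on the
    drift integrate to bounds on [ln (mgf t)]. *)
Lemma is_derive_ln_mgf (t : R) : is_derive t 1 (fun u => ln (mgf u)) (drift t).
Proof.
have M0 := mgf_gt0 q01 t.
have dexp (c k : R) : is_derive t 1 (fun u => c * expR (k * u)) (c * (expR (k * t) * k)).
  have := is_derive1M (is_derive_cst c t 1)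
    (is_derive1_comp (is_derive_expR (k * t)) (is_derive1_mull k t)).
  by rewrite mul0r add0r.
have ME u : q * expR ((1 - q) * u) + (1 - q) * expR (- q * u) = mgf u.
  by rewrite /mgf mulrC [u * (1 - q)]mulrC mulNr [u * q]mulrC mulrC.
have dM := is_derive1D (dexp q (1 - q)) (dexp (1 - q) (- q)).
rewrite (funext ME) in dM.
apply: (is_derive_eq (is_derive1_comp (is_derive1_ln M0) dM)).
rewrite /drift /tilt -[in RHS]ME -[in LHS]ME mulrC [t * _]mulrC; field.
by rewrite ME gt_eqF.
Qed.

Lemma drift_bounds t : 0 <= t <= 2^-1 ->
  v * t * (1 - 2 * t) <= drift t <= v * t * (1 + 2 * t).
Proof.
move=> /andP[t0 t2].
have e1 : 1 + t <= expR t by exact: expR_ge1Dx.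
have e2 : 1 - t <= expR (- t) by exact: expR_ge1Dx.
have eE : expR t * expR (- t) = 1 by rewrite -expRD subrr expR0.
(* [expR t * (1 - t) <= 1], while [(1 + t + 2 t^2)(1 - t) = 1 + t^2 (1 - 2 t) >= 1]. *)
have e3 : expR t <= 1 + t + 2 * t ^+ 2.
  have : expR t * (1 - t) <= 1 by rewrite -[leRHS]eE ler_wpM2l// expR_ge0.
  have : 0 <= t ^+ 2 * (1 - 2 * t) by rewrite mulr_ge0 ?sqr_ge0//; lra.
  move=> h1 h2.
  rewrite -(@ler_pM2r _ (1 - t)); last by lra.
  apply: le_trans h2 _; lra.
have D1 : 1 <= 1 - q + q * expR t.
  have : 0 <= q * (expR t - 1) by rewrite mulr_ge0 ?(ltW q0)//; lra.
  lra.
have D0 : 0 < 1 - q + q * expR t by lra.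
rewrite driftE; apply/andP; split.
  rewrite ler_pdivlMr// -!(mulrA v) ler_pM2l//.
  apply: (@le_trans _ _ t); last by lra.
  rewrite -mulrA ler_piMr//.
  apply: (@le_trans _ _ ((1 - t) * expR t)).
    apply: ler_pM; [by lra|by exact: ltW|by lra|].
    have : 0 <= (1 - q) * (expR t - 1) by rewrite mulr_ge0 ?(ltW q1)//; lra.
    lra.
  by rewrite -[leRHS]eE mulrC ler_wpM2l// expR_ge0.
rewrite ler_pdivrMr// -!(mulrA v) ler_pM2l//.
apply: (@le_trans _ _ (t * (1 + 2 * t))); first by lra.
by rewrite ler_peMr// mulr_ge0//; lra.
Qed.

(** Both sides vanish at 0, so it suffices to compare derivatives: those of the bounds are
    [v x - 3 v x^2] and [v x + 3 v x^2], while [drift_bounds] keeps the drift within [2 v x^2] of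
    [v x]. *)
Lemma ln_mgf_bounds t : 0 <= t <= 2^-1 ->
  v * t ^+ 2 / 2 * (1 - 2 * t) <= ln (mgf t) <= v * t ^+ 2 / 2 * (1 + 2 * t).
Proof.
move=> /andP[t0 t2].
have l0 : ln (mgf 0) = 0.
  by rewrite /mgf !mul0r oppr0 expR0 !mulr1 addrC subrK ln1.
have dP (k x : R) : is_derive x 1 (fun u => v * u ^+ 2 / 2 * (1 + k * u))
   (v * x + 3 / 2 * v * k * x ^+ 2).
  have d2 := is_derive1M (is_derive1_mull v x) (is_derive1_mull (2^-1) x).
  have dk := is_derive1D (is_derive_cst (1 : R) x 1) (is_derive1_mull k x).
  have := is_derive1M d2 dk; rewrite (_ : (fun t => _) = (fun u => v * u ^+ 2 / 2 * (1 + k * u))); last first.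
    by apply/funext => u /=; field.
  move=> dd; apply: (is_derive_eq dd).
  by rewrite /=; field.
apply/andP; split.
- have := @derive_ge0_le R (fun u => ln (mgf u) + - (v * u ^+ 2 / 2 * (1 + - 2 * u))) _ 0 t t0
    (fun x _ => is_derive1D (is_derive_ln_mgf x) (is_deriveN (dP (- 2) x))).
  rewrite l0 expr0n/= mulr0 !mul0r subr0 subr_ge0 mulNr; apply.
  move=> x /andP[x0 xt].
  have /drift_bounds/andP[d1 _] : 0 <= x <= 2^-1 by rewrite x0 (le_trans xt).
  have : 0 <= v * x ^+ 2 by rewrite mulr_ge0 ?sqr_ge0// ltW.
  nra.
- have := @derive_ge0_le R (fun u => v * u ^+ 2 / 2 * (1 + 2 * u) + - ln (mgf u)) _ 0 t t0
    (fun x _ => is_derive1D (dP 2 x) (is_deriveN (is_derive_ln_mgf x))).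
  rewrite l0 expr0n/= mulr0 !mul0r subr0 subr_ge0; apply.
  move=> x /andP[x0 xt].
  have /drift_bounds/andP[_ d1] : 0 <= x <= 2^-1 by rewrite x0 (le_trans xt).
  have : 0 <= v * x ^+ 2 by rewrite mulr_ge0 ?sqr_ge0// ltW.
  nra.
Qed.

(** In [bern_hit] the level contributes [-(1 + d) N v t^2] to the exponent, and since [2 t <= d] the
    factor [mgf t ^+ N] gives back at most half of it. *)
Lemma hit_bound (N : nat) (t d : R) : 0 <= t <= 2^-1 -> 2 * t <= d ->
  bern q N (hit q ((1 + d) * (N%:R * v * t))) <=
  expR (- ((1 + d) * (N%:R * v * t ^+ 2) / 2)).
Proof.
move=> t02 td; have /andP[t0 t2] := t02.
apply: le_trans (bern_hit q01 _ _ t0) _.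
rewrite -[mgf t](@lnK R) ?posrE ?mgf_gt0// -expRM_natl -expRD ler_expR.
have /andP[_ l2] := ln_mgf_bounds t02.
have : N%:R * ln (mgf t) <= N%:R * (v * t ^+ 2 / 2 * (1 + d)).
  apply: ler_wpM2l; first exact: ler0n.
  apply: le_trans l2 _; apply: ler_wpM2l; last by lra.
  by rewrite divr_ge0// mulr_ge0 ?sqr_ge0// ltW.
lra.
Qed.

(** [bern_lower] with [w = sqrt N] and the start chosen to cancel the drift: the square vanishes and
    Chebyshev loses only [(N / 4) / w^2 = 1/4]. The factor [1 + 6 t] collects the relative errors of
    [ln (mgf t)] and of the drift. *)
Lemma lower_tail (N : nat) (t : R) : 0 <= t <= 2^-1 -> (0 < N)%N ->
  3 / 4 * expR (- (N%:R * v * t ^+ 2 / 2 * (1 + 6 * t) + t * Num.sqrt N%:R)) <=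
  bern q N (fun s => N%:R * v * t * (1 - 2 * t) - Num.sqrt N%:R <= walk q s).
Proof.
move=> t02 N0; have /andP[t0 t2] := t02.
have NR : 0 < N%:R :> R by rewrite ltr0n.
set w := Num.sqrt N%:R; have w0 : 0 < w by rewrite sqrtr_gt0.
have w2 : w ^+ 2 = N%:R by rewrite sqr_sqrtr// ltW.
have /andP[l1 _] := ln_mgf_bounds t02.
have /andP[d1 d2] := drift_bounds t02.
have := bern_lower q01 N (w - N%:R * drift t) t0 w0.
rewrite w2 (_ : (w - _ - _ + _) ^+ 2 = 0); last by ring.
rewrite add0r (_ : N%:R / 4 / N%:R = 4^-1); last by field; rewrite gt_eqF.
rewrite -[mgf t](@lnK R) ?posrE ?mgf_gt0// -expRM_natl -expRD => h.
apply: (@le_trans _ _ (bern q N (fun s => 0 <= w - N%:R * drift t + walk q s))); last first.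
  apply: le_bern => // s _ /= h1.
  have : N%:R * (v * t * (1 - 2 * t)) <= N%:R * drift t by rewrite ler_pM2l.
  lra.
apply: le_trans h; rewrite [leRHS]mulrC; apply: ler_pM; rewrite ?expR_ge0//; first by lra.
rewrite ler_expR.
have : N%:R * (v * t ^+ 2 / 2 * (1 - 2 * t)) <= N%:R * ln (mgf t) by rewrite ler_pM2l.
have : N%:R * t * drift t <= N%:R * t * (v * t * (1 + 2 * t)).
  by rewrite ler_wpM2l// mulr_ge0// ltW.
lra.
Qed.

End mgf_bounds.

(** * Central limit theorem for Bernoulli walks *)

Section gaussian_cdf.
Context (R : realType).
Implicit Types s x z : R.

(** Real-valued, so that it can be differentiated; [s] is the standard deviation. *)
Definition gcdf s x : R := fine (normal_prob 0 s `]-oo, x]).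

Lemma gcdfE s x : (gcdf s x)%:E = normal_prob 0 s `]-oo, x].
Proof. by rewrite /gcdf fineK// fin_num_measure. Qed.

Lemma is_derive_gcdf s x : s != 0 -> is_derive x 1 (gcdf s) (normal_pdf 0 s x).
Proof.
move=> s0.
have x1 : x < x + 1 by rewrite ltrDl.
have fi : lebesgue_measure.-integrable `]-oo, (x + 1)] (EFin \o normal_pdf 0 s).
  by apply: integrableS (integrable_normal_pdf 0 s).
have [|dF dE] := continuous_FTC1 x1 fi (ltNyr x).
  exact: continuous_normal_pdf.
apply: DeriveDef; first exact: dF.
rewrite -derive1E; exact: dE.
Qed.

(** As a random variable under the normal law itself, the identity has [gcdf s] as distribution
    function, which supplies the limits at both infinities. *)
Let idR : measurableTypeR R -> R := idfun.

HB.instance Definition _ :=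
  @isMeasurableFun.Build _ _ _ _ idR (@measurable_id _ (measurableTypeR R) setT).

Let cdf_gcdf s : cdf (idR : {RV normal_prob 0 s >-> R}) = EFin \o gcdf s.
Proof. by apply/funext => x; rewrite /= gcdfE. Qed.

Lemma cvg_gcdfy s : gcdf s x @[x --> +oo] --> (1 : R).
Proof. by have := cvg_cdfy1 (idR : {RV normal_prob 0 s >-> R}); rewrite cdf_gcdf => /fine_cvg. Qed.

Lemma cvg_gcdfNy s : gcdf s x @[x --> -oo] --> (0 : R).
Proof. by have := cvg_cdfNy0 (idR : {RV normal_prob 0 s >-> R}); rewrite cdf_gcdf => /fine_cvg. Qed.

(** The two sides have the same derivative and the same limit at minus infinity. *)
Lemma gcdf_scale s x : 0 < s -> gcdf s x = gcdf 1 (x / s).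
Proof.
move=> s0; have s_neq0 : s != 0 by rewrite gt_eqF.
pose D (x : R) := gcdf s x - gcdf 1 (s^-1 * x).
have D0 (y : R) : is_derive y 1 D 0.
  have d1 := is_derive1_comp (is_derive_gcdf (s^-1 * y) (oner_neq0 R)) (is_derive1_mull s^-1 y).
  apply: (is_derive_eq (is_derive1D (is_derive_gcdf y s_neq0) (is_deriveN d1))).
  rewrite !normal_pdfE ?oner_eq0//= /normal_peak /normal_fun.
  rewrite expr1n mul1r -mulrnAr sqrtrM ?sqr_ge0// sqrtr_sqr gtr0_norm// !subr0.
  have -> : - (s^-1 * y) ^+ 2 / (1 *+ 2) = - y ^+ 2 / (s ^+ 2 *+ 2).
    by field.
  by rewrite invfM; ring.
have DE (y : R) : D x = D y by exact: is_derive_0_is_cst.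
have lim0 : D y @[y --> -oo] --> (0 - 0 : R).
  apply: cvgB; first exact: cvg_gcdfNy.
  apply: (cvg_comp _ _ _ (cvg_gcdfNy 1)).
  apply: gt0_cvgMrNy; first by rewrite invr_gt0.
  exact: cvg_id.
have lim1 : D y @[y --> -oo] --> D x.
  by rewrite (_ : D = cst (D x)); [exact: cvg_cst|apply/funext => y; rewrite -DE].
have D0x : D x = 0 - 0 := cvg_unique (@Rhausdorff R) lim1 lim0.
by apply: subr0_eq; rewrite [x / s]mulrC -[LHS]/(D x) D0x subr0.
Qed.

Lemma nondecreasing_gcdf s : {homo gcdf s : x y / x <= y}.
Proof.
move=> x y xy; rewrite /gcdf fine_le ?fin_num_measure//.
by rewrite le_measure ?inE//; exact: subitvPr.
Qed.

Lemma normal_cdf_gcdf s x : 0 < s -> normal_cdf s x = (gcdf 1 (x / Num.sqrt s))%:E.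
Proof. by move=> s0; rewrite -gcdf_scale ?sqrtr_gt0// gcdfE. Qed.

End gaussian_cdf.

(** * Taylor bounds and derivatives of the normal distribution function *)

Section heat.
Context (R : realType).

(** The bound on [df] is asked only up to [|d|], so that [B] may itself contain powers of [|d|]; the
    Taylor bounds below iterate this. *)
Lemma abs_mean_value (f df : R -> R) (B d : R) :
  (forall x : R, is_derive x 1 f (df x)) -> f 0 = 0 ->
  (forall x, `|x| <= `|d| -> `|df x| <= B) -> `|f d| <= B * `|d|.
Proof.
move=> dff f0 dfB.
have [d0|/ltW d0] := leP 0 d.
  have [c /andP[c0 cd]] := mean_value d0 (fun x _ => dff x).
  rewrite f0 !subr0 => ->; rewrite normrM ler_wpM2r// dfB// !ger0_norm//.
have [c /andP[c0 cd]] := mean_value d0 (fun x _ => dff x).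
rewrite f0 !sub0r => /eqP; rewrite eqr_oppLR => /eqP ->.
by rewrite normrN normrM normrN ler_wpM2r// dfB// !ler0_norm// lerN2.
Qed.

Lemma is_derive1_addl (f f1 : R -> R) (x u : R) :
  (forall y : R, is_derive y 1 f (f1 y)) ->
  is_derive u 1 (fun t => f (x + t)) (f1 (x + u)).
Proof.
move=> df; have := is_derive1_comp (df (x + u))
  (is_derive1D (is_derive_cst x u 1) (is_derive_id u 1)).
by rewrite add0r mulr1.
Qed.

(** The remainder has derivative [f1 (x + t) - f1 x], to which the mean value bound applies again;
    the sharp factor 1/2 is given up. *)
Lemma taylor2 (f f1 f2 : R -> R) (B x d : R) :
  (forall x : R, is_derive x 1 f (f1 x)) ->
  (forall x : R, is_derive x 1 f1 (f2 x)) ->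
  (forall x, `|f2 x| <= B) -> `|f (x + d) - f x - d * f1 x| <= B * `|d| ^+ 2.
Proof.
move=> df df1 f2B.
rewrite expr2 mulrA.
pose g t := f (x + t) + - (f x) + - (f1 x * t).
have -> : f (x + d) - f x - d * f1 x = g d by rewrite /g mulrC.
apply: (@abs_mean_value g (fun t => f1 (x + t) - f1 x)).
- move=> u; apply: (is_derive_eq (is_derive1D (is_derive1D (is_derive1_addl x u df)
    (is_derive_cst (- f x) u 1)) (is_deriveN (is_derive1_mull (f1 x) u)))).
  by rewrite addr0.
- by rewrite /g addr0 mulr0 oppr0 addr0 subrr.
move=> u ud; apply: (@le_trans _ _ (B * `|u|)); last first.
  by rewrite ler_wpM2l// (le_trans (normr_ge0 _) (f2B 0)).
apply: (@abs_mean_value (fun t => f1 (x + t) + - f1 x) (fun t => f2 (x + t))) => //.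
- move=> w; apply: (is_derive_eq (is_derive1D (is_derive1_addl x w df1) (is_derive_cst (- f1 x) w 1))).
  by rewrite addr0.
- by rewrite addr0 subrr.
Qed.

Lemma taylor3 (f f1 f2 f3 : R -> R) (B x d : R) :
  (forall x : R, is_derive x 1 f (f1 x)) ->
  (forall x : R, is_derive x 1 f1 (f2 x)) ->
  (forall x : R, is_derive x 1 f2 (f3 x)) ->
  (forall x, `|f3 x| <= B) ->
  `|f (x + d) - f x - d * f1 x - d ^+ 2 / 2 * f2 x| <= B * `|d| ^+ 3.
Proof.
move=> df df1 df2 f3B.
rewrite [leRHS](_ : _ = B * `|d| ^+ 2 * `|d|); last by ring.
pose g t := f (x + t) + - (f x) + - (f1 x * t) + - (f2 x / 2 * t * t).
have -> : f (x + d) - f x - d * f1 x - d ^+ 2 / 2 * f2 x = g d by rewrite /g; field.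
apply: (@abs_mean_value g (fun t => f1 (x + t) - f1 x - t * f2 x)).
- move=> u; apply: (is_derive_eq (is_derive1D (is_derive1D (is_derive1D (is_derive1_addl x u df)
    (is_derive_cst (- f x) u 1)) (is_deriveN (is_derive1_mull (f1 x) u)))
    (is_deriveN (is_derive1M (is_derive1_mull (f2 x / 2) u) (is_derive_id u 1))))).
  by rewrite addr0; field.
- by rewrite /g addr0; ring.
move=> u ud; apply: (le_trans (taylor2 _ _ df1 df2 f3B)).
rewrite ler_wpM2l// ?(le_trans (normr_ge0 _) (f3B 0))//.
by rewrite ler_pXn2r ?nnegrE.
Qed.

Local Notation Phi := (gcdf (1 : R)).
Local Notation phi := (normal_pdf (0 : R) 1).

Lemma normal_pdf01E (z : R) : phi z = normal_peak 1 * expR (- (z ^+ 2 / 2)).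
Proof. by rewrite normal_pdfE ?oner_eq0//= /normal_fun subr0 expr1n mulNr mulr2n. Qed.

Lemma normal_peak1_le1 : normal_peak (1 : R) <= 1.
Proof.
rewrite /normal_peak invf_le1 ?sqrtr_gt0 ?expr1n ?mul1r; last first.
  by rewrite mulrn_wgt0// pi_gt0.
rewrite -[leLHS]sqrtr1 ler_wsqrtr// mulr2n.
have := pi_ge2 R; lra.
Qed.

Lemma is_derive_Phi (z : R) : is_derive z 1 Phi (phi z).
Proof. by apply: is_derive_gcdf; rewrite oner_eq0. Qed.

Lemma is_derive_phi (z : R) : is_derive z 1 phi (- z * phi z).
Proof.
rewrite (_ : phi = fun z => normal_peak 1 * expR (- (z ^+ 2 / 2))); last first.
  by apply/funext => u; exact: normal_pdf01E.
pose g (t : R) := - 2^-1 * t * t.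
have d1 : is_derive z 1 g _ := is_derive1M (is_derive1_mull (- 2^-1) z) (is_derive_id z 1).
have d2 := is_derive1M (is_derive_cst (normal_peak 1) z 1)
   (is_derive1_comp (is_derive_expR (g z)) d1).
rewrite (_ : (fun t => _) = (fun z => normal_peak 1 * expR (- (z ^+ 2 / 2)))) in d2; last first.
  by apply/funext => u /=; congr (_ * expR _); rewrite /g; field.
apply: (is_derive_eq d2).
have gE : g z = - (z ^+ 2 / 2) by rewrite /g; field.
by rewrite /= gE; field.
Qed.

Lemma phi_bound0 (z : R) : 0 <= phi z <= 1.
Proof.
rewrite normal_pdf_ge0/=; apply: le_trans normal_peak1_le1.
by apply: normal_pdf_ub; rewrite oner_eq0.
Qed.

(* From [1 + u <= expR u] at [u = z^2/4], squared. *)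
Lemma phi_bound4 (z : R) : (1 + z ^+ 2 / 4) ^+ 2 * phi z <= 1.
Proof.
rewrite normal_pdf01E mulrCA; apply: (le_trans _ normal_peak1_le1).
rewrite ler_piMr ?normal_peak_ge0//.
have -> : expR (- (z ^+ 2 / 2)) = expR (- (z ^+ 2 / 4)) ^+ 2.
  by rewrite -expRM_natl; congr expR; field.
rewrite -exprMn; apply: exprn_ile1.
  by rewrite mulr_ge0 ?expR_ge0// addr_ge0// divr_ge0// sqr_ge0.
rewrite -[leRHS](expRxMexpNx_1 (z ^+ 2 / 4)) ler_wpM2r ?expR_ge0//.
exact: expR_ge1Dx.
Qed.

Lemma is_derive_Nzphi (z : R) :
  is_derive z 1 (fun z => - z * phi z) ((z ^+ 2 - 1) * phi z).
Proof.
have d := is_derive1M (is_derive1_mull (- 1) z) (is_derive_phi z).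
rewrite (_ : (fun t => _) = (fun z => - z * phi z)) in d; last first.
  by apply/funext => u; rewrite mulN1r.
by apply: (is_derive_eq d); ring.
Qed.

(** Expanded, [phi_bound4] bounds [phi], [z^2 phi] and [z^4 phi] together; odd powers of [z] are
    then dominated through nonnegative squares. The next two bounds are obtained in the same way. *)
Lemma Nzphi_bound (z : R) : `|- z * phi z| <= 2.
Proof.
have := phi_bound4 z; have /andP[p0 p1] := phi_bound0 z.
have z2 : 0 <= z ^+ 2 * phi z by rewrite mulr_ge0// sqr_ge0.
have z4 : 0 <= z ^+ 4 * phi z by rewrite mulr_ge0// exprn_even_ge0.
rewrite normrM normrN (ger0_norm p0) => b.
have : 0 <= (`|z| - 1) ^+ 2 * phi z by rewrite mulr_ge0 ?sqr_ge0.
rewrite sqrrB real_normK ?num_real// expr1n mulr1 => h.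
nra.
Qed.

Lemma phi2_bound (z : R) : `|(z ^+ 2 - 1) * phi z| <= 3.
Proof.
have := phi_bound4 z; have /andP[p0 p1] := phi_bound0 z.
have z2 : 0 <= z ^+ 2 * phi z by rewrite mulr_ge0// sqr_ge0.
have z4 : 0 <= z ^+ 4 * phi z by rewrite mulr_ge0// exprn_even_ge0.
rewrite ler_norml => b; apply/andP; split; nra.
Qed.

Lemma phi3_bound (z : R) : `|(z - z ^+ 3) * phi z| <= 12.
Proof.
have := phi_bound4 z; have /andP[p0 p1] := phi_bound0 z.
have z2 : 0 <= z ^+ 2 * phi z by rewrite mulr_ge0// sqr_ge0.
have z4 : 0 <= z ^+ 4 * phi z by rewrite mulr_ge0// exprn_even_ge0.
have h1 : 0 <= (z - 1) ^+ 2 * phi z by rewrite mulr_ge0// sqr_ge0.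
have h2 : 0 <= (z + 1) ^+ 2 * phi z by rewrite mulr_ge0// sqr_ge0.
have h3 : 0 <= (z ^+ 2 - z) ^+ 2 * phi z by rewrite mulr_ge0// sqr_ge0.
have h4 : 0 <= (z ^+ 2 + z) ^+ 2 * phi z by rewrite mulr_ge0// sqr_ge0.
rewrite ler_norml => b; apply/andP; split; nra.
Qed.

End heat.

(** * One step of the approximate heat equation *)

Section heat_step.
Context (R : realType) (q : R).
Hypothesis q01 : 0 < q < 1.
Let q0 : 0 < q. Proof. by case/andP: q01. Qed.
Let q1 : 0 < 1 - q. Proof. by rewrite subr_gt0; case/andP: q01. Qed.
Let v := q * (1 - q).
Let v0 : 0 < v. Proof. by rewrite mulr_gt0. Qed.
Let v1 : v <= 1. Proof. by rewrite mulr_ile1//; [exact: ltW|exact: ltW|rewrite -subr_ge0 ltW|rewrite gerBl ltW]. Qed.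
Local Notation Phi := (gcdf (1 : R)).
Local Notation phi := (normal_pdf (0 : R) 1).

(** A step is centred with variance [v]: averaging the Taylor expansions over one bit kills the
    first-order terms and leaves [v h^2 / 2] times the second derivative of [Phi]. *)
Lemma space_step (z h : R) : 0 <= h ->
  `|q * Phi (z - (1 - q) * h) + (1 - q) * Phi (z + q * h) - Phi z
    - v * h ^+ 2 / 2 * (- z * phi z)| <= 3 * h ^+ 3.
Proof.
move=> h0.
have T k : `|k| <= h -> `|Phi (z + k) - Phi z - k * phi z - k ^+ 2 / 2 * (- z * phi z)| <= 3 * h ^+ 3.
  move=> kh; apply: le_trans (taylor3 z k (@is_derive_Phi R) (@is_derive_phi R)
    (@is_derive_Nzphi R) (@phi2_bound R)) _.
  by rewrite ler_pM2l// lerXn2r// nnegrE.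
have k1 : `|- (1 - q) * h| <= h.
  rewrite mulNr normrN ger0_norm; last by rewrite mulr_ge0// ltW.
  by rewrite ler_piMl//; have := q0; have := q1; lra.
have k2 : `|q * h| <= h.
  rewrite ger0_norm; last by rewrite mulr_ge0// ltW.
  by rewrite ler_piMl//; have := q0; have := q1; lra.
have := T _ k1; have := T _ k2; rewrite mulNr.
set P0 := Phi z; set P1 := Phi (z - _); set P2 := Phi (z + q * h).
set p0 := phi z; set B := 3 * h ^+ 3 => {}k2 {}k1.
have -> : q * P1 + (1 - q) * P2 - P0 - v * h ^+ 2 / 2 * (- z * p0) =
  q * (P1 - P0 - - ((1 - q) * h) * p0 - (- ((1 - q) * h)) ^+ 2 / 2 * (- z * p0)) +
  (1 - q) * (P2 - P0 - q * h * p0 - (q * h) ^+ 2 / 2 * (- z * p0)).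
  by rewrite /v; field.
apply: le_trans (ler_normD _ _) _.
rewrite !normrM (gtr0_norm q0) (gtr0_norm q1).
apply: (@le_trans _ _ (q * B + (1 - q) * B)); last by rewrite -mulrDl addrC subrK mul1r.
by apply: lerD; rewrite ler_pM2l.
Qed.

(** Lengthening time shrinks the argument of [Phi] by a factor [expR (- u)]. Since [y' = - y] along
    this curve, the derivative at 0 is [- z * phi z], the same expression as in [space_step]: this
    is the heat equation. *)
Lemma time_step (z u : R) :
  `|Phi (z * expR (- u)) - Phi z - u * (- z * phi z)| <= 12 * u ^+ 2.
Proof.
pose y (t : R) := z * expR (- t).
have dy (t : R) : is_derive t 1 y (- y t).
  have d1 := is_derive1M (is_derive_cst z t 1)
    (is_derive1_comp (is_derive_expR (-1 * t)) (is_derive1_mull (-1) t)).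
  rewrite (_ : (fun t => _) = y) in d1; last by apply/funext => s; rewrite /y/= mulN1r.
  by apply: (is_derive_eq d1); rewrite /y/= mulN1r; ring.
have d1 (t : R) : is_derive t 1 (Phi \o y) (- y t * phi (y t)).
  by apply: (is_derive_eq (is_derive1_comp (is_derive_Phi (y t)) (dy t))); rewrite mulrC.
have d2 (t : R) : is_derive t 1 (fun t => - y t * phi (y t)) ((y t - y t ^+ 3) * phi (y t)).
  apply: (is_derive_eq (is_derive1_comp (is_derive_Nzphi (y t)) (dy t))).
  by ring.
have := taylor2 0 u d1 d2 (fun t => phi3_bound (y t)).
by rewrite /= /y add0r oppr0 expR0 mulr1 real_normK ?num_real.
Qed.

Lemma heat_step (s x : R) : 1 <= s ->
  `|Phi (x / Num.sqrt (s + v)) -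
    (q * Phi ((x - (1 - q)) / Num.sqrt s) + (1 - q) * Phi ((x + q) / Num.sqrt s))|
  <= 7 / (s * Num.sqrt s).
Proof.
move=> s1; have s0 : 0 < s by lra.
set r := Num.sqrt s; have r0 : 0 < r by rewrite sqrtr_gt0.
have r2 : r ^+ 2 = s by rewrite sqr_sqrtr// ltW.
have r1 : 1 <= r by rewrite -[leLHS]sqrtr1 ler_wsqrtr.
pose h := r^-1; pose d := v * h ^+ 2; pose z := x * h.
have h0 : 0 < h by rewrite invr_gt0.
have h1 : h <= 1 by rewrite invf_le1.
have d0 : 0 < d by rewrite mulr_gt0// exprn_gt0.
have dh : d <= h ^+ 2 by rewrite ler_piMl// sqr_ge0.
have D0 : 0 < 1 + d by lra.
(* Chosen so that [expR (- u)] is the ratio of [sqrt s] to [sqrt (s + v)]; to first order [u] is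
   [d / 2]. *)
pose u := ln (1 + d) / 2.
have sE : x / Num.sqrt (s + v) = z * expR (- u).
  have -> : s + v = s * (1 + d) by rewrite /d /h exprVn r2; field; rewrite gt_eqF.
  rewrite sqrtrM ?(ltW s0)// -/r invfM mulrA; congr (_ * _).
  rewrite expRN; congr (_^-1).
  have e2 : expR u ^+ 2 = 1 + d.
    by rewrite -expRM_natl /u mulrC divfK// lnK// posrE.
  by rewrite -e2 sqrtr_sqr ger0_norm// expR_ge0.
have u1 : u <= d / 2 by rewrite /u ler_pM2r// le_ln1Dx//; lra.
have u2 : d / 2 - u <= d ^+ 2 / 2.
  rewrite /u -mulrBl ler_pM2r//.
  have : ln (1 + d)^-1 <= (1 + d)^-1 - 1.
    rewrite -[X in ln X](subrK 1) addrC; apply: le_ln1Dx.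
    by rewrite ltrBrDl subrr invr_gt0.
  rewrite lnV ?posrE// => l1.
  have : (1 + d)^-1 <= 1 - d + d ^+ 2.
    rewrite -[leLHS]mul1r ler_pdivrMr//.
    have : 0 <= d ^+ 3 by rewrite exprn_ge0// ltW.
    lra.
  lra.
have u0 : 0 <= u by rewrite divr_ge0// ln_ge0//; lra.
have -> : (x - (1 - q)) / r = z - (1 - q) * h by rewrite mulrBl.
have -> : (x + q) / r = z + q * h by rewrite mulrDl.
rewrite sE.
have := time_step z u; have := space_step z (ltW h0).
have := Nzphi_bound z.
set A := Phi (z * _); set B := q * _ + _; set m := - z * phi z => mB sB tB.
have u2d : u ^+ 2 <= (d / 2) ^+ 2 by rewrite lerXn2r// nnegrE// divr_ge0// ltW.
have h3 : d ^+ 2 <= h ^+ 3.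
  apply: (@le_trans _ _ ((h ^+ 2) ^+ 2)).
    by rewrite lerXn2r// nnegrE ?sqr_ge0// ltW.
  by rewrite -exprM ler_wiXn2l// ltW.
have -> : 7 / (s * r) = 7 * h ^+ 3 by rewrite /h -r2 -exprSr exprVn.
(* The three errors are at most [12 u^2 <= 3 d^2], [3 h^3] and [d^2]; as [d^2 <= h^3], they add up
   to [7 h^3]. *)
have -> : A - B = (A - Phi z - u * m) - (B - Phi z - d / 2 * m) + (u - d / 2) * m by ring.
apply: le_trans (ler_normD _ _) _.
have mu : `|(u - d / 2) * m| <= d ^+ 2 / 2 * 2.
  rewrite normrM distrC; apply: ler_pM => //.
  by rewrite ger0_norm// subr_ge0.
apply: le_trans (lerD (ler_normB _ _) mu) _.
apply: le_trans (lerD (lerD tB sB) (lexx _)) _.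
have {}u2d : u ^+ 2 <= d ^+ 2 / 4 by apply: le_trans u2d _; rewrite le_eqVlt; apply/orP; left; apply/eqP; field.
lra.
Qed.

End heat_step.

(** * From the heat-equation barrier to the central limit theorem *)

Section de_moivre_laplace.
Context (R : realType) (q : R).
Hypothesis q01 : 0 < q < 1.
Let q0 : 0 < q. Proof. by case/andP: q01. Qed.
Let q1 : 0 < 1 - q. Proof. by rewrite subr_gt0; case/andP: q01. Qed.
Let v := q * (1 - q).
Let v0 : 0 < v. Proof. by rewrite mulr_gt0. Qed.
Local Notation Phi := (gcdf (1 : R)).

Lemma gcdf_ge0 (s x : R) : 0 <= gcdf s x.
Proof. by rewrite /gcdf fine_ge0. Qed.

Lemma gcdf_le1 (s x : R) : gcdf s x <= 1.
Proof. by rewrite -lee_fin gcdfE probability_le1. Qed.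

Definition walk_cdf (n : nat) (x : R) : R := bern q n (fun s => walk q s <= x).

Lemma walk_cdfS n x : walk_cdf n.+1 x =
  q * walk_cdf n (x - (1 - q)) + (1 - q) * walk_cdf n (x + q).
Proof.
rewrite /walk_cdf bernS; congr (_ * _ + _ * _); apply: (eq_bern q01) => s _.
  by rewrite walk_cons mulr1n lerBrDl.
by rewrite walk_cons mulr0n sub0r addrC lerBlDr.
Qed.

(** Makes the errors of [heat_step] telescope. With [a^2 = k] and [b^2 = k + 1], the difference of
    inverses is [1 / (a b (a + b))], and [b <= 3 a / 2] gives [b (a + b) <= 15 a^2 / 4]. *)
Lemma inv_sqrt_telescope (k : R) : 1 <= k ->
  (k * Num.sqrt k)^-1 <= 4 * ((Num.sqrt k)^-1 - (Num.sqrt (k + 1))^-1).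
Proof.
move=> k1; have k0 : 0 < k by lra.
set a := Num.sqrt k; set b := Num.sqrt (k + 1).
have a0 : 0 < a by rewrite sqrtr_gt0.
have b0 : 0 < b by rewrite sqrtr_gt0; lra.
have a2 : a ^+ 2 = k by rewrite sqr_sqrtr// ltW.
have b2 : b ^+ 2 = k + 1 by rewrite sqr_sqrtr//; lra.
have ab : b <= 3 / 2 * a.
  rewrite -(@ler_pXn2r _ 2) ?nnegrE ?ltW//; last by rewrite mulr_gt0//; lra.
  by rewrite exprMn a2 b2; lra.
have -> : a^-1 - b^-1 = (a * b * (a + b))^-1.
  have : (b - a) * (a + b) = 1.
    have -> : (b - a) * (a + b) = b ^+ 2 - a ^+ 2 by ring.
    by rewrite b2 a2; ring.
  move=> h; have ab0 : a + b != 0 by rewrite gt_eqF// addr_gt0.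
  apply: (mulIf ab0); rewrite invfM mulfVK// -[X in _ = X]mulr1 -h.
  by field; rewrite !gt_eqF.
have h1 : b * (a + b) <= (3 / 2 * a) * (5 / 2 * a).
  apply: ler_pM => //; [exact: ltW|by rewrite ltW// addr_gt0|lra].
have h2 : a * (b * (a + b)) <= a * ((3 / 2 * a) * (5 / 2 * a)) by rewrite ler_pM2l.
have a3 : 0 <= a ^+ 3 by rewrite exprn_ge0// ltW.
rewrite -a2 -[4]invrK -invfM lef_pV2 ?posrE ?mulr_gt0 ?invr_gt0 ?addr_gt0//.
lra.
Qed.

(* [Phi (x / sqrt s)] solves the heat equation, hence is an approximate solution
   of the recursion satisfied by [walk_cdf]; the errors are summable. *)
Lemma walk_cdf_barrier (m : nat) (A e : R) : 1 <= v * m%:R ->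
  Phi (- A / Num.sqrt (v * m%:R)) <= e -> 1 - e <= Phi (A / Num.sqrt (v * m%:R)) ->
  forall n x t E, t = Num.sqrt (v * (m + n)%:R) ->
  E = e + 28 / (v * Num.sqrt v) * ((Num.sqrt m%:R)^-1 - (Num.sqrt (m + n)%:R)^-1) ->
  Phi ((x - A) / t) - E <= walk_cdf n x <= Phi ((x + A) / t) + E.
Proof.
move=> vm eA1 eA2.
have e0 : 0 <= e by exact: le_trans (gcdf_ge0 _ _) eA1.
have v1 : v <= 1.
  by rewrite mulr_ile1//; [exact: ltW|exact: ltW|rewrite -subr_ge0 ltW|rewrite gerBl ltW].
have m1 : 1 <= m%:R :> R.
  by apply: le_trans vm _; rewrite ler_piMl.
elim=> [|n IH] x t E -> -> {t E}.
  rewrite addn0 subrr mulr0 addr0 /walk_cdf/= walk_nil.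
  have t0 : 0 <= (Num.sqrt (v * m%:R))^-1 by rewrite invr_ge0.
  (* At time 0 the distribution function is a unit step at 0, and the shifts by [A] move [Phi] to
     the correct side of it up to [e]. *)
  case: (leP 0 x) => x0; rewrite ?mulr1n ?mulr0n; apply/andP; split.
  - by have := gcdf_le1 1 ((x - A) / Num.sqrt (v * m%:R)); lra.
  - rewrite -lerBlDr; apply: le_trans eA2 _; apply: nondecreasing_gcdf.
    by rewrite ler_wpM2r// lerDr.
  - rewrite subr_le0; apply: le_trans eA1; apply: nondecreasing_gcdf.
    by rewrite ler_wpM2r// gerDr ltW.
  - by rewrite addr_ge0// gcdf_ge0.
have mn1 : 1 <= (m + n)%:R :> R by rewrite (le_trans m1)// ler_nat leq_addr.
pose s := v * (m + n)%:R.
have s1 : 1 <= s by apply: le_trans vm _; rewrite ler_pM2l// ler_nat leq_addr.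
have tE : Num.sqrt (v * (m + n.+1)%:R) = Num.sqrt (s + v).
  by rewrite /s addnS -natr1 mulrDr mulr1.
have step y := heat_step q01 y s1.
rewrite -/v in step.
(* 28 is 7 from [heat_step] times 4 from [inv_sqrt_telescope]. *)
have err : 7 / (s * Num.sqrt s) <= 28 / (v * Num.sqrt v) *
    ((Num.sqrt (m + n)%:R)^-1 - (Num.sqrt (m + n.+1)%:R)^-1).
  have := inv_sqrt_telescope mn1; rewrite natr1 -addnS => h.
  have -> : 7 / (s * Num.sqrt s) =
      7 / (v * Num.sqrt v) * ((m + n)%:R * Num.sqrt (m + n)%:R)^-1.
    by rewrite /s sqrtrM ?(ltW v0)// -[RHS]mulrA -invfM; congr (_ / _); ring.
  rewrite (_ : 28 / _ = 7 / (v * Num.sqrt v) * 4); last by ring.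
  rewrite -[leRHS]mulrA ler_wpM2l// divr_ge0// mulr_ge0 ?sqrtr_ge0// ltW//.
rewrite walk_cdfS tE.
have /andP[l1 u1] := IH (x - (1 - q)) _ _ erefl erefl.
have /andP[l2 u2] := IH (x + q) _ _ erefl erefl.
rewrite -/s in l1 u1 l2 u2.
set E0 := e + _ in l1 u1 l2 u2.
set E := e + _.
have EE : E0 + 7 / (s * Num.sqrt s) <= E by rewrite /E0 /E; lra.
clearbody E E0; clear IH.
have mix a b c : q * (a + c) + (1 - q) * (b + c) = q * a + (1 - q) * b + c by ring.
apply/andP; split.
  have := step (x - A); rewrite ler_norml => /andP[_].
  rewrite (_ : x - A - (1 - q) = x - (1 - q) - A); last by ring.
  rewrite (_ : x - A + q = x + q - A); last by ring.
  move=> h; apply: le_trans (lerD (ler_wpM2l (ltW q0) l1) (ler_wpM2l (ltW q1) l2)).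
  rewrite mix; set X := q * _ + _ in h *; clearbody X; move: h EE.
  by set e1 := 7 / _; clearbody e1; clear; lra.
have := step (x + A); rewrite ler_norml => /andP[+ _].
rewrite (_ : x + A - (1 - q) = x - (1 - q) + A); last by ring.
rewrite (_ : x + A + q = x + q + A); last by ring.
move=> h; apply: le_trans (lerD (ler_wpM2l (ltW q0) u1) (ler_wpM2l (ltW q1) u2)) _.
rewrite mix; set X := q * _ + _ in h *; clearbody X; move: h EE.
by set e1 := 7 / _; clearbody e1; clear; lra.
Qed.

Lemma continuous_Phi : continuous Phi.
Proof.
move=> x; apply/differentiable_continuous/derivable1_diffP.
by apply: ex_derive; exact: is_derive_Phi.
Qed.

(** [m] is fixed first to make the accumulated error small, then [A] to fit the initial step; for
    fixed [m] and [A] both shifts disappear as [n] grows. Letting the level [x n] vary later absorbs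
    bounded perturbations of the walk. *)
Lemma de_moivre_laplace (x : nat -> R) (y : R) :
  x n / Num.sqrt n%:R @[n --> \oo] --> y ->
  walk_cdf n (x n) @[n --> \oo] --> Phi (y / Num.sqrt v).
Proof.
move=> xy.
have sv0 : 0 < Num.sqrt v by rewrite sqrtr_gt0.
apply/cvgrPdist_le => e e0.
set K := 28 / (v * Num.sqrt v).
have K0 : 0 < K by rewrite divr_gt0// mulr_gt0.
have [m [vm mK]] : exists m : nat, 1 <= v * m%:R /\ K / Num.sqrt m%:R <= e / 4.
  (* The first summand secures [1 <= v * m%:R], the second [K / sqrt m <= e / 4]. *)
  pose a := v^-1 + (4 * K / e) ^+ 2; exists (Num.truncn a).+1.
  have ma : a <= (Num.truncn a).+1%:R by rewrite ltW// truncnS_gt.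
  have c0 : 0 < 4 * K / e by rewrite divr_gt0// mulr_gt0.
  split.
    rewrite mulrC -ler_pdivrMr// mul1r; apply: le_trans ma.
    by rewrite lerDl sqr_ge0.
  rewrite ler_pdivrMr ?sqrtr_gt0// mulrC -ler_pdivrMr; last by rewrite divr_gt0.
  rewrite invf_div mulrA (mulrC K) -[leLHS]ger0_norm ?(ltW c0)// -sqrtr_sqr ler_wsqrtr//.
  by apply: le_trans ma; rewrite lerDr invr_ge0 ltW.
have [A [A1 A2]] : exists A : R, Phi (- A / Num.sqrt (v * m%:R)) <= e / 4 /\
   1 - e / 4 <= Phi (A / Num.sqrt (v * m%:R)).
  have e4 : 0 < e / 4 by rewrite divr_gt0.
  have /cvgrPdist_le/(_ _ e4)[B1 [_ B1P]] := @cvg_gcdfy R 1.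
  have /cvgrPdist_le/(_ _ e4)[B2 [_ B2P]] := @cvg_gcdfNy R 1.
  pose B := `|B1| + `|B2| + 1.
  have b1 := ler_norm B1; have b2 := ler_norm (- B2); rewrite normrN in b2.
  have n1 := normr_ge0 B1; have n2 := normr_ge0 B2.
  have vm0 : Num.sqrt (v * m%:R) != 0 by rewrite gt_eqF// sqrtr_gt0 (lt_le_trans ltr01).
  exists (B * Num.sqrt (v * m%:R)); rewrite mulNr mulfK//; split.
    have : - B < B2 by rewrite /B; lra.
    by move/B2P; rewrite sub0r normrN ler_norml => /andP[].
  have : B1 < B by rewrite /B; lra.
  by move/B1P; rewrite ler_norml => /andP[_]; rewrite lerBlDr lerBlDl.
have lim (B : R) : Phi ((x n + B) / Num.sqrt (v * (m + n)%:R)) @[n --> \oo] --> Phi (y / Num.sqrt v).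
  apply: (@cvg_comp _ _ _ _ Phi _ (nbhs (y / Num.sqrt v))); last exact: continuous_Phi.
  have nV := @natV_cvg0 R; have sV := @sqrt_natV_cvg0 R.
  have sR : Num.sqrt (1 + m%:R * n%:R^-1)^-1 @[n --> \oo] --> (1 : R).
    have h1 : 1 + m%:R * (n%:R : R)^-1 @[n --> \oo] --> (1 + m%:R * 0 : R).
      by apply: cvgD; [exact: cvg_cst|exact: cvgMr].
    rewrite mulr0 addr0 in h1.
    have h2 : (1 + m%:R * (n%:R : R)^-1)^-1 @[n --> \oo] --> (1^-1 : R).
      by apply: cvgV => //; exact: oner_neq0.
    rewrite invr1 in h2.
    by have := cvg_comp _ _ h2 (@sqrt_continuous R 1); rewrite sqrtr1.
  have -> : y / Num.sqrt v = (y + B * 0) * 1 / Num.sqrt v by rewrite mulr0 addr0 mulr1.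
  apply: (@cvg_trans _ ((x n / Num.sqrt n%:R + B * Num.sqrt (n%:R)^-1) *
     Num.sqrt (1 + m%:R * n%:R^-1)^-1 / Num.sqrt v @[n --> \oo])).
    apply: near_eq_cvg; near=> n.
    have n0 : 0 < n%:R :> R by rewrite ltr0n; near: n; exact: nbhs_infty_gt.
    have -> : (m + n)%:R = n%:R * (1 + m%:R * n%:R^-1) :> R.
      by rewrite natrD; field; rewrite gt_eqF.
    rewrite (sqrtrM _ (ltW v0)) (sqrtrM _ (ltW n0)) !sqrtrV ?(ltW n0)//.
    by rewrite !invfM; ring.
  by apply: cvgMl; apply: cvgM => //; apply: cvgD => //; apply: cvgMr.
have /cvgrPdist_le/(_ (e / 2)) limA := lim A.
have /cvgrPdist_le/(_ (e / 2)) limB := lim (- A).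
near=> n.
have := walk_cdf_barrier vm A1 A2 (x n) (erefl _) (erefl (_ + _ * (_ - (Num.sqrt (m + n)%:R)^-1))).
have : `|Phi (y / Num.sqrt v) - Phi ((x n + A) / Num.sqrt (v * (m + n)%:R))| <= e / 2.
  by near: n; apply: limA; rewrite divr_gt0.
have : `|Phi (y / Num.sqrt v) - Phi ((x n - A) / Num.sqrt (v * (m + n)%:R))| <= e / 2.
  by near: n; apply: limB; rewrite divr_gt0.
rewrite -/K; set P := Phi _; set P1 := Phi _; set P2 := Phi _; set F := walk_cdf _ _.
have : K * ((Num.sqrt m%:R)^-1 - (Num.sqrt (m + n)%:R)^-1) <= e / 4.
  by apply: le_trans mK; rewrite ler_pM2l// gerBl invr_ge0.
set D := K * _; clearbody P P1 P2 F D; rewrite !ler_norml; clear.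
move=> ? /andP[? ?] /andP[? ?] /andP[? ?]; apply/andP; split; lra.
Unshelve. all: by end_near. Qed.

End de_moivre_laplace.

(** * Law of the iterated logarithm for Bernoulli walks *)

Section bit_sequences.
Context d (T : measurableType d) (R : realType) (P : probability T R).
Implicit Types (e : nat -> T -> bool) (C : set T) (q : R).

Definition bits e n w : seq bool := mkseq (e ^~ w) n.

Lemma size_bits e n w : size (bits e n w) = n.
Proof. exact: size_mkseq. Qed.

Lemma bitsS e n w : bits e n.+1 w = rcons (bits e n w) (e n w).
Proof. by rewrite /bits /mkseq -addn1 iotaD map_cat cats1. Qed.

Lemma take_bits e m n w : (m <= n)%N -> take m (bits e n w) = bits e m w.
Proof. by move=> mn; rewrite /bits /mkseq -map_take take_iota (minn_idPl mn). Qed.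

Definition measurable_bits e := forall i, measurable [set w | e i w].

Definition bit_weight q (s : seq bool) : R := \prod_(b <- s) (if b then q else 1 - q).

(* The bits [e i] are i.i.d. Bernoulli [q] and independent of the event [C]. *)
Definition bernoulli_bits q C e := forall s : seq bool,
  P (C `&` [set w | bits e (size s) w = s]) = (P C * (bit_weight q s)%:E)%E.

Lemma measurable_bits_pred e n (Q : pred (seq bool)) : measurable_bits e ->
  measurable [set w | Q (bits e n w)].
Proof.
move=> me; elim: n Q => [|n IH] Q.
  case: (boolP (Q [::])) => Q0.
    by rewrite (_ : [set _ | _] = setT)//; apply/seteqP; split.
  by rewrite (_ : [set _ | _] = set0)//; apply/seteqP; split=> // w /=; apply/negP.
rewrite (_ : [set _ | _] =
    ([set w | e n w] `&` [set w | Q (rcons (bits e n w) true)]) `|`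
    (~` [set w | e n w] `&` [set w | Q (rcons (bits e n w) false)])); last first.
  apply/seteqP; split => w; rewrite /= bitsS.
    by case: (e n w) => ?; [left|right].
  by case=> -[]; case: (e n w).
apply: measurableU; apply: measurableI => //.
- exact: (IH (fun s => Q (rcons s true))).
- exact: measurableC.
- exact: (IH (fun s => Q (rcons s false))).
Qed.

(** Generalised to words with a fixed prefix [s], by induction on the number of free bits: splitting
    on the bit after [s] reproduces the recursion of [bern]. *)
Lemma bernoulli_bits_law q C e n (Q : pred (seq bool)) :
  measurable C -> measurable_bits e -> bernoulli_bits q C e ->
  P (C `&` [set w | Q (bits e n w)]) = (P C * (bern q n Q)%:E)%E.
Proof.
move=> mC me be.
suff H (s : seq bool) :
   P (C `&` [set w | bits e (size s) w = s]
      `&` [set w | Q (bits e (size s + n) w)])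
    = (P C * (bit_weight q s * bern q n (fun t => Q (s ++ t)))%:E)%E.
  have := H [::]; rewrite /bit_weight big_nil mul1r add0n => <-.
  by congr (P _); apply/seteqP; split => w /=; [case|case=> -[]].
elim: n s => [|n IH] s /=.
  rewrite cats0 addn0; case: (boolP (Q s)) => Qs.
    rewrite mulr1 -be; congr (P _); apply/seteqP; split => w /=; first by case.
    by move=> [Cw ws]; rewrite ws.
  rewrite mulr0 mule0 -[RHS](@measure0 _ _ _ P); congr (P _).
  by apply/seteqP; split => // w /= [[_ ->]]; apply/negP.
have msets (b : bool) : measurable (C `&` [set w | bits e (size (rcons s b)) w = rcons s b]
      `&` [set w | Q (bits e (size (rcons s b) + n) w)]).
  apply: measurableI; last exact: measurable_bits_pred.
  apply: measurableI => //.
  rewrite (_ : [set _ | _] = [set w | bits e (size (rcons s b)) w == rcons s b]).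
    exact: (@measurable_bits_pred e _ (fun t => t == rcons s b)).
  by apply/seteqP; split => w /= /eqP.
rewrite (_ : _ `&` _ `&` _ =
  (C `&` [set w | bits e (size (rcons s true)) w = rcons s true]
      `&` [set w | Q (bits e (size (rcons s true) + n) w)]) `|`
  (C `&` [set w | bits e (size (rcons s false)) w = rcons s false]
      `&` [set w | Q (bits e (size (rcons s false) + n) w)])); last first.
  apply/seteqP; split => w /=; rewrite !size_rcons addSn addnS.
    move=> [[Cw ws] Qw]; case ew : (e (size s) w); [left|right];
      by split => //; split => //; rewrite bitsS ws ew.
  by move=> [|] [[Cw]]; rewrite bitsS => /rcons_inj [ws _] Qw.
set A := _ `&` _ `&` [set w | _]; set B := _ `&` _ `&` [set w | Q _].
have AB0 : A `&` B = set0.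
  apply/seteqP; split => // w [] [[_ /= h1] _] [[_ /= h2] _].
  by move: h1 h2; rewrite !size_rcons => -> /rcons_inj[].
have PA := IH (rcons s true); have PB := IH (rcons s false).
apply: (eq_trans (measureU P (msets true) (msets false) AB0)).
apply: (eq_trans (f_equal2 +%E PA PB)).
rewrite -muleDr; last 2 first.
- by rewrite fin_num_measure.
- by [].
congr (_ * _)%E; rewrite -EFinD; congr EFin.
rewrite /bit_weight -!cats1 !big_cat/= !big_seq1.
have E b : bern q n (fun t => Q ((s ++ [:: b]) ++ t)) = bern q n (fun t => Q (s ++ b :: t)).
  by congr (bern _ _ _); apply/funext => t; rewrite -catA.
by rewrite !E; ring.
Qed.

End bit_sequences.

(** * Upper half of the law of the iterated logarithm *)

Section lil_upper.
Context d (T : measurableType d) (R : realType) (P : probability T R).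

(** First Borel-Cantelli lemma: the partial sums of the probabilities are at most
    [g 0 - g n <= g 0]. *)
Lemma borel_cantelli_telescope (F : nat -> set T) (g : nat -> R) :
  (forall j, measurable (F j)) -> (forall j, 0 <= g j) ->
  (forall j, (P (F j) <= (g j - g j.+1)%:E)%E) ->
  {ae P, forall w, exists n, forall j, (n <= j)%N -> ~ F j w}.
Proof.
move=> mF g0 PF; exists (lim_sup_set F); split.
- by apply: bigcapT_measurable => n; apply: bigcup_measurable.
- apply: lim_sup_set_cvg0 => //.
  apply: (@le_lt_trans _ _ (g 0%N)%:E); last by rewrite ltry.
  apply: lime_le; first by apply: is_cvg_nneseries.
  apply: nearW => n; apply: (@le_trans _ _ (g 0%N - g n)%:E); last first.
    by rewrite lee_fin gerBl.
  elim: n => [|n IH]; first by rewrite big_nil subrr.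
  rewrite big_nat_recr//=; apply: le_trans (leeD IH (PF n)) _.
  by rewrite -EFinD lee_fin addrA subrK.
- move=> w /= h n _; apply: contrapT => hn; apply: h; exists n => j nj Fj.
  by apply: hn; exists j.
Qed.

Definition lil_scale (n : nat) : R := Num.sqrt (2 * n%:R * ln (ln n%:R)).

(* Mean value theorem for [x^-a]; makes [sum k^-(1+a)] telescope. *)
Lemma power_telescope (x r a : R) : 0 < x -> 0 < r -> 0 < a ->
  expR (- ((1 + a) * ln (x + r))) <=
  expR (- (a * ln x)) / (a * r) - expR (- (a * ln (x + r))) / (a * r).
Proof.
move=> x0 r0 a0.
have xr : x <= x + r by rewrite lerDl ltW.
have df (u : R) : x <= u <= x + r ->
    is_derive u 1 (fun u => expR (- a * ln u)) (- a * expR (- ((1 + a) * ln u))).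
  move=> /andP[xu _]; have u0 : 0 < u by exact: lt_le_trans xu.
  have d1 := is_derive1M (is_derive_cst (- a) u 1) (is_derive1_ln u0).
  pose h (t : R) := - a * ln t.
  have {}d1 : is_derive u 1 h _ := d1.
  apply: (is_derive_eq (is_derive1_comp (is_derive_expR (h u)) d1)).
  rewrite (_ : - ((1 + a) * ln u) = h u - ln u); last by rewrite /h; ring.
  by rewrite expRD expRN lnK ?posrE//= ; ring.
have [c /andP[xc cx]] := mean_value xr df.
rewrite (_ : x + r - x = r); last by ring.
rewrite -!(mulNr a) => E; have c0 : 0 < c by exact: lt_le_trans xc.
rewrite -mulrBl (_ : expR _ - expR _ = a * r * expR (- ((1 + a) * ln c))); last first.
  by rewrite -[LHS]opprB E; ring.
rewrite [leRHS]mulrC mulKf ?gt_eqF ?mulr_gt0// ler_expR lerN2 ler_pM2l; last by lra.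
by rewrite ler_ln ?posrE//; lra.
Qed.

Variables (q : R) (e : nat -> T -> bool).
Hypotheses (q01 : 0 < q < 1) (me : measurable_bits e).
Hypothesis be : bernoulli_bits P q setT e.
Let q0 : 0 < q. Proof. by case/andP: q01. Qed.
Let q1 : 0 < 1 - q. Proof. by rewrite subr_gt0; case/andP: q01. Qed.
Let v := q * (1 - q).
Let v0 : 0 < v. Proof. by rewrite mulr_gt0. Qed.

Lemma bits_law n (Q : pred (seq bool)) : P [set w | Q (bits e n w)] = (bern q n Q)%:E.
Proof.
have := bernoulli_bits_law n Q measurableT me be.
by rewrite setTI probability_setT mul1e.
Qed.

Definition block_len (y : R) : nat := Num.truncn (expR y).
(** The tilt with [N v t^2 / 2 = L], for which the exponent in [hit_bound] becomes [-(1 + d) L]. *)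
Definition block_tilt (N : nat) (L : R) : R := Num.sqrt (2 * L / (N%:R * v)).

(** This is [hit_bound] once [2 t <= a]. As [N >= expR y / 2 >= y^2 / 8] and [ln y <= y], one has
    [t^2 <= 16 / (v y)], at most [a^2 / 4] by the condition with 64. *)
Lemma block_bound (N : nat) (y r a : R) : 0 < a <= 1 -> 0 < r -> 1 <= y -> 64 / (v * a ^+ 2) <= y ->
  N = block_len (y + r) ->
  bern q N (hit q ((1 + a) * (N%:R * v * block_tilt N (ln y)))) <=
  expR (- ((1 + a) * ln y)).
Proof.
move=> /andP[a0 a1] r0 y1 ya NE; set t := block_tilt _ _.
have y0 : 0 < y by lra.
have L0 : 0 <= ln y by rewrite ln_ge0.
have Ly : ln y <= y by rewrite (le_trans (ltW (ln_sublinear y0))).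
have ey : (y / 2) ^+ 2 <= expR y.
  have -> : expR y = expR (y / 2) ^+ 2 by rewrite -expRM_natl; congr expR; field.
  rewrite lerXn2r ?nnegrE ?expR_ge0 ?divr_ge0 ?ltW//.
  by have := expR_ge1Dx (y / 2); lra.
have ey2 : 2 <= expR y by have := expR_ge1Dx y; lra.
have eN : expR y / 2 <= N%:R.
  have : expR y <= expR (y + r) by rewrite ler_expR; lra.
  have : expR (y + r) < N.+1%:R by rewrite NE truncnS_gt.
  by rewrite -natr1; lra.
have N0 : 0 < N%:R :> R by lra.
have Nv0 : 0 < N%:R * v by rewrite mulr_gt0.
have t0 : 0 <= t by rewrite sqrtr_ge0.
have t2 : t ^+ 2 = 2 * ln y / (N%:R * v) by rewrite sqr_sqrtr// divr_ge0 ?(ltW Nv0)// mulr_ge0.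
have ta : t <= a / 2.
  rewrite -(@ler_pXn2r _ 2) ?nnegrE//; last by rewrite divr_ge0// ltW.
  rewrite t2 ler_pdivrMr//.
  move: ya; rewrite ler_pdivrMr; last by rewrite mulr_gt0// exprn_gt0.
  move=> ya; apply: (@le_trans _ _ (2 * y)); first by lra.
  apply: (@le_trans _ _ ((a / 2) ^+ 2 * (y ^+ 2 / 8 * v))); last first.
    rewrite ler_pM2l ?exprn_gt0 ?divr_gt0// ler_pM2r//; lra.
  rewrite (_ : (a / 2) ^+ 2 * (y ^+ 2 / 8 * v) = y * (y * (v * a ^+ 2)) / 32); last by field.
  by rewrite ler_pdivlMr// mulrAC mulrC ler_pM2l//; lra.
have t12 : 0 <= t <= 2^-1 by rewrite t0; lra.
have t2a : 2 * t <= a by lra.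
apply: le_trans (hit_bound q01 N t12 t2a) _; rewrite -/v t2 ler_expR lerN2.
by rewrite le_eqVlt; apply/orP; left; apply/eqP; field; rewrite !gt_eqF.
Qed.

(** One factor [1 + a] comes from the level in [block_bound], the other from replacing [n] by the
    end of its block. *)
Lemma lil_upper (a : R) : 0 < a <= 1 ->
  {ae P, forall w, \forall n \near \oo,
     walk q (bits e n w) <= (1 + a) ^+ 2 * Num.sqrt v * lil_scale n}.
Proof.
move=> a01; have /andP[a0 a1] := a01.
(* Block ends grow by the ratio [expR r = (1 + a)^2], whose square root enters the scale. *)
pose r := 2 * ln (1 + a).
have r0 : 0 < r by rewrite mulr_gt0// ln_gt0//; lra.
have [k1 k1P] : exists k1 : nat, 1 + 64 / (v * a ^+ 2) <= k1%:R * r.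
  exists (Num.truncn ((1 + 64 / (v * a ^+ 2)) / r)).+1.
  by rewrite -ler_pdivrMr// ltW// truncnS_gt.
have va0 : 0 <= 64 / (v * a ^+ 2) by rewrite divr_ge0// mulr_ge0// ?sqr_ge0// ltW.
have kr (j : nat) : 1 + 64 / (v * a ^+ 2) <= (j + k1)%:R * r.
  by apply: le_trans k1P _; rewrite ler_pM2r// ler_nat leq_addl.
(* The extra [r] gives [y j] the form [x + r] of [power_telescope], with [x] the argument used in
   [g j]. *)
pose y (j : nat) := (j + k1)%:R * r + r.
pose N j := block_len (y j + r).
pose F j := [set w | hit q ((1 + a) * ((N j)%:R * v * block_tilt (N j) (ln (y j)))) (bits e (N j) w)].
pose g j := expR (- (a * ln ((j + k1)%:R * r))) / (a * r).
have mF j : measurable (F j) by exact: measurable_bits_pred.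
have g0 j : 0 <= g j by rewrite divr_ge0 ?expR_ge0// mulr_ge0// ltW.
have PF j : (P (F j) <= (g j - g j.+1)%:E)%E.
  rewrite /F bits_law lee_fin; apply: (@le_trans _ _ (expR (- ((1 + a) * ln (y j))))).
    by apply: (block_bound a01 r0 _ _ erefl); have := kr j; rewrite /y; lra.
  rewrite /g (_ : (j.+1 + k1)%:R * r = (j + k1)%:R * r + r); last first.
    by rewrite addSn -natr1 mulrDl mul1r.
  by apply: power_telescope => //; have := kr j; lra.
apply: filterS (borel_cantelli_telescope mF g0 PF) => w [n0 wF].
near=> n.
have n_gt1 : (1 < n)%N by near: n; exact: nbhs_infty_gt.
have nR : 0 < n%:R :> R by rewrite ltr0n ltnW.
have ln0 : 0 < ln (n%:R : R) by rewrite ln_gt0// ltr1n.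
pose k := Num.truncn (ln (n%:R : R) / r).
have /andP[k_le k_gt] : k%:R * r <= ln (n%:R : R) < k.+1%:R * r.
  by rewrite -ler_pdivlMr// -ltr_pdivrMr// truncnS_gt andbT truncn_le// divr_ge0// ltW.
have kbig : (n0 + k1 + 1 <= k)%N.
  rewrite /k truncn_ge_nat ?divr_ge0 ?(ltW r0) ?(ltW ln0)//.
  rewrite ler_pdivlMr// -ler_expR lnK ?posrE//.
  by near: n; exact: nbhs_infty_ger.
(* With this index [y j = k r <= ln n < y j + r], so the block ending at [N j] contains time [n]. *)
pose j := (k - (k1 + 1))%N.
have k1k : (k1 + 1 <= k)%N by rewrite (leq_trans _ kbig)// -addnA leq_addl.
have jk : (j + k1 + 1 = k)%N by rewrite -addnA subnK.
have n0j : (n0 <= j)%N by rewrite leq_subRL// addnC addnA.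
have yk : y j = k%:R * r by rewrite /y -jk [in RHS]natrD mulrDl mul1r.
have y1 : 1 <= y j by have := kr j; rewrite /y; lra.
have := wF _ n0j; rewrite /F /=.
set x := (1 + a) * _ => /negP nhit.
have nN : (n <= N j)%N.
  rewrite /N /block_len yk truncn_ge_nat ?expR_ge0//.
  rewrite -[leLHS]lnK ?posrE// ler_expR -{2}[r]mul1r -mulrDl natr1; exact: ltW.
have NR : (N j)%:R <= (1 + a) ^+ 2 * n%:R.
  rewrite (le_trans (y := expR (y j + r))) ?truncn_le ?expR_ge0// yk expRD mulrC.
  apply: ler_pM; rewrite ?expR_ge0//.
    by rewrite /r expRM_natl lnK ?posrE//; lra.
  by rewrite -[leRHS]lnK ?posrE// ler_expR.
have wx : walk q (bits e n w) <= x.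
  rewrite leNgt; apply/negP => /ltW wx; apply: (negP nhit).
  by apply: (@hit_walk _ _ _ _ n); rewrite take_bits.
apply: (le_trans wx).
have N0 : 0 < (N j)%:R :> R by rewrite ltr0n (leq_trans _ nN)// ltnW.
have L0 : 0 <= ln (y j) by rewrite ln_ge0.
have -> : x = (1 + a) * (Num.sqrt v * Num.sqrt (2 * (N j)%:R * ln (y j))).
  rewrite /x /block_tilt; congr (_ * _).
  have Nv : 0 < (N j)%:R * v by rewrite mulr_gt0.
  rewrite -sqrtrM ?(ltW v0)// -{1}[(N j)%:R * v]gtr0_norm// -sqrtr_sqr -sqrtrM ?sqr_ge0//.
  by congr Num.sqrt; field; rewrite !gt_eqF.
rewrite [leRHS](_ : _ = (1 + a) * (Num.sqrt v * ((1 + a) * lil_scale n))); last by ring.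
rewrite ler_pM2l; last by lra.
rewrite ler_pM2l ?sqrtr_gt0// /lil_scale.
rewrite -[X in _ <= X * _]gtr0_norm; last by lra.
rewrite -sqrtr_sqr -sqrtrM ?sqr_ge0// ler_wsqrtr//.
have LL : ln (y j) <= ln (ln (n%:R : R)).
  by rewrite ler_ln ?posrE//; [rewrite yk|lra].
rewrite [leRHS](_ : _ = 2 * ((1 + a) ^+ 2 * n%:R) * ln (ln n%:R)); last by ring.
by apply: ler_pM => //; rewrite ler_pM2l.
Unshelve. all: by end_near. Qed.

End lil_upper.

(** * Complementing the bits *)

Section flip.
Context d (T : measurableType d) (R : realType) (P : probability T R).
Variables (q : R) (e : nat -> T -> bool).

(** Complementation negates the walk and replaces [q] by [1 - q], preserving [q (1 - q)]; it
    converts upper bounds into lower bounds. *)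
Definition flip_bits (i : nat) (w : T) : bool := ~~ e i w.

Lemma bits_flip n w : bits flip_bits n w = map negb (bits e n w).
Proof. by rewrite /bits /mkseq -map_comp. Qed.

Lemma walk_negb s : walk (1 - q) (map negb s) = - walk q s.
Proof.
elim: s => [|b s IH] /=; first by rewrite !walk_nil oppr0.
by rewrite !walk_cons IH; case: b => /=; ring.
Qed.

Lemma measurable_flip_bits : measurable_bits e -> measurable_bits flip_bits.
Proof.
move=> me i; rewrite (_ : [set w | _] = ~` [set w | e i w]); first exact: measurableC.
by apply/seteqP; split => w /= /negP.
Qed.

Lemma bernoulli_flip_bits C : bernoulli_bits P q C e -> bernoulli_bits P (1 - q) C flip_bits.
Proof.
move=> be s; have := be (map negb s).
have -> : bit_weight q (map negb s) = bit_weight (1 - q) s.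
  rewrite /bit_weight big_map; apply: eq_bigr => b _.
  by case: b => //=; rewrite opprB addrC subrK.
move=> <-; congr (P (_ `&` _)); rewrite size_map; apply/seteqP; split => w /=; rewrite bits_flip.
  by move=> /(congr1 (map negb)); rewrite (mapK negbK).
by move=> ->; rewrite (mapK negbK).
Qed.

End flip.

(** * Second Borel-Cantelli lemma for disjoint blocks *)

Section second_borel_cantelli.
Context d (T : measurableType d) (R : realType) (P : probability T R).
Variables (q : R) (e : nat -> T -> bool).
Hypotheses (q01 : 0 < q < 1) (me : measurable_bits e).
Hypothesis be : bernoulli_bits P q setT e.

(** By independence of the blocks, the probability of no success is a product of factors
    [1 - u <= expR (- u)]. The lower bounds on the success probabilities telescope to a logarithm,
    hence their sum diverges. *)
Lemma block_borel_cantelli (M : nat -> nat) (good : nat -> pred (seq bool)) (c : R) (k1 : nat) :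
  {homo M : m n / (m <= n)%N} -> 0 < c ->
  (forall k, (k1 <= k)%N ->
    c * (ln k.+2%:R - ln k.+1%:R) <= bern q (M k.+1 - M k) (good k)) ->
  {ae P, forall w, forall k0, exists2 k, (k0 <= k)%N & good k (drop (M k) (bits e (M k.+1) w))}.
Proof.
move=> Mle c0 gP.
pose hitk k w := good k (drop (M k) (bits e (M k.+1) w)).
have mhit k : measurable [set w | ~~ hitk k w].
  exact: (measurable_bits_pred (M k.+1) (fun s => ~~ good k (drop (M k) s)) me).
pose E k0 := \bigcap_(k in [set k | (k0 <= k)%N]) [set w | ~~ hitk k w].
have mE k0 : measurable (E k0) by apply: bigcap_measurable => //; exists k0 => /=.
suff PE k0 : (k1 <= k0)%N -> P (E k0) = 0.
  apply: (@ae_foralln _ _ _ P (fun k0 w => exists2 k, (k0 <= k)%N & hitk k w)) => k0.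
  exists (E (maxn k0 k1)); split => //; first exact: PE (leq_maxr _ _).
  move=> w /= nh k /= km; apply/negP => hk; apply: nh; exists k => //.
  by rewrite (leq_trans _ km)// leq_maxl.
move=> k10.
(* No success in the [j] blocks from [k0] on, peeling off the last block so that [bern_cat]
   applies. *)
pose no := fix no j (s : seq bool) := if j is j'.+1 then
  no j' (take (M (k0 + j')%N) s) && ~~ good (k0 + j')%N (drop (M (k0 + j')%N) s) else true.
have noE j w : no j (bits e (M (k0 + j)%N) w) = all (fun i => ~~ hitk (k0 + i)%N w) (iota 0 j).
  elim: j => // j IH; rewrite (_ : iota 0 j.+1 = iota 0 j ++ [:: j]); last first.
    by rewrite -addn1 iotaD.
  by rewrite all_cat -IH /= andbT addnS take_bits// Mle.
have bno j : bern q (M (k0 + j)%N) (no j) <= expR (- (c * (ln (k0 + j).+1%:R - ln k0.+1%:R))).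
  elim: j => [|j IH]; first by rewrite addn0 subrr mulr0 oppr0 expR0 /= bern_xpredT.
  have -> : M (k0 + j.+1)%N = (M (k0 + j)%N + (M (k0 + j)%N.+1 - M (k0 + j)%N))%N.
    by rewrite addnS subnKC// Mle.
  rewrite /= (bern_cat q01 _ _ (no j) (fun t => ~~ good (k0 + j)%N t)).
  rewrite bern_predC.
  set D := ln k0.+1%:R in IH *.
  have -> : - (c * (ln (k0 + j.+1).+1%:R - D)) = - (c * (ln (k0 + j).+1%:R - D)) +
      (- (c * (ln (k0 + j).+2%:R - ln (k0 + j).+1%:R))) by rewrite addnS; ring.
  rewrite expRD; apply: ler_pM => //; first exact: bern_ge0.
    by rewrite -bern_predC bern_ge0.
  apply: le_trans (expR_ge1Dx _); rewrite lerD2l lerN2; apply: gP.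
  by rewrite (leq_trans k10)// leq_addr.
apply/eqP; rewrite eq_le measure_ge0 andbT; apply/lee_addgt0Pr => eps eps0.
rewrite add0e.
(* Enough blocks for the exponential bound [bno] to fall below [eps]. *)
pose j := Num.truncn (expR (ln k0.+1%:R - ln eps / c) : R).
apply: (@le_trans _ _ (P [set w | no j (bits e (M (k0 + j)%N) w)])).
  apply: le_measure; rewrite ?inE//; first exact: measurable_bits_pred.
  move=> w Ew /=; rewrite noE; apply/allP => i _; apply: Ew => /=; exact: leq_addr.
rewrite (bits_law me be) lee_fin; apply: le_trans (bno j) _.
rewrite -[leRHS]lnK ?posrE// ler_expR lerNl -ler_pdivrMl//.
have : ln k0.+1%:R - ln eps / c <= ln (k0 + j).+1%:R.
  rewrite -[leLHS]expRK ler_ln ?posrE ?expR_gt0// ltW//.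
  by rewrite (lt_le_trans (truncnS_gt _))// ler_nat ltnS leq_addl.
lra.
Qed.

End second_borel_cantelli.

(** * Lower tail of a single block *)

Section block_tail.
Context (R : realType) (q : R).
Hypothesis (q01 : 0 < q < 1).
Let q0 : 0 < q. Proof. by case/andP: q01. Qed.
Let q1 : 0 < 1 - q. Proof. by rewrite subr_gt0; case/andP: q01. Qed.
Let v := q * (1 - q).
Let v0 : 0 < v. Proof. by rewrite mulr_gt0. Qed.

(** The tilt has [N v t^2 / 2 = (1 - a) L]; the spare [a L] in the exponent pays for [6 t] and for
    [t sqrt N]. In the level, one [a] each is lost to the smaller tilt, to the factor [1 - 2 t], and
    to [sqrt N]. *)
Lemma block_lower (N : nat) (L a : R) : 0 < a <= 2^-1 -> (0 < N)%N ->
  8 / (v * a ^+ 2) <= L -> 2 * L / (N%:R * v) <= (a / 12) ^+ 2 ->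
  3 / 4 * expR (- L) <=
  bern q N (fun s => (1 - 3 * a) * (Num.sqrt v * Num.sqrt (2 * N%:R * L)) <= walk q s).
Proof.
move=> /andP[a0 a1] N0 La LN.
have NR : 0 < N%:R :> R by rewrite ltr0n.
have va0 : 0 < v * a ^+ 2 by rewrite mulr_gt0// exprn_gt0.
have L0 : 0 < L by apply: lt_le_trans La; rewrite divr_gt0.
have Nv0 : 0 < N%:R * v by rewrite mulr_gt0.
have aL : 8 <= L * (v * a ^+ 2) by rewrite -ler_pdivrMr.
pose t := Num.sqrt (2 * (1 - a) * L / (N%:R * v)).
have t0 : 0 <= t by rewrite sqrtr_ge0.
have a1' : 0 < 1 - a by lra.
have t2 : t ^+ 2 = 2 * (1 - a) * L / (N%:R * v).
  by rewrite sqr_sqrtr// divr_ge0 ?(ltW Nv0)// !mulr_ge0// ltW.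
have ta : t <= a / 12.
  rewrite -(@ler_pXn2r _ 2) ?nnegrE//; last by rewrite divr_ge0// ltW.
  apply: le_trans LN; rewrite t2 ler_pM2r ?invr_gt0//.
  by rewrite ler_pM2r//; lra.
have t12 : 0 <= t <= 2^-1 by rewrite t0; lra.
set W := Num.sqrt v * Num.sqrt (2 * N%:R * L).
have W0 : 0 <= W by rewrite mulr_ge0// sqrtr_ge0.
have W2 : W ^+ 2 = 2 * L * (N%:R * v).
  by rewrite exprMn !sqr_sqrtr ?(ltW v0)//; [ring|rewrite !mulr_ge0// ltW].
pose r := Num.sqrt (N%:R : R); have r0 : 0 <= r by rewrite sqrtr_ge0.
have r2 : r ^+ 2 = N%:R by rewrite sqr_sqrtr// ltW.
have Nvt2 : N%:R * v * t ^+ 2 = 2 * (1 - a) * L by rewrite t2 mulrC divfK ?gt_eqF.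
apply: le_trans (le_trans _ (lower_tail q01 t12 N0)) _; rewrite -/v -/r.
  rewrite ler_pM2l// ler_expR lerN2 Nvt2.
  have tr : t * r <= a * L / 2.
    rewrite -(@ler_pXn2r _ 2) ?nnegrE ?mulr_ge0//; [|exact: ltW|exact: ltW].
    rewrite exprMn r2 -(ler_pM2r v0) [leLHS](_ : _ = N%:R * v * t ^+ 2); last by ring.
    rewrite Nvt2.
    have h1 : 2 * (1 - a) * L <= 2 * L by rewrite ler_pM2r//; lra.
    apply: le_trans h1 _; rewrite [leRHS](_ : _ = L * (L * (v * a ^+ 2)) / 4); last by field.
    by rewrite ler_pdivlMr// mulrAC mulrC ler_pM2l//; lra.
  have : (1 - a) * L * (6 * t) <= (1 - a) * L * (a / 2).
    by rewrite ler_pM2l ?mulr_gt0//; lra.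
  have : 0 <= a ^+ 2 * L by rewrite mulr_ge0 ?sqr_ge0// ltW.
  lra.
apply: (le_bern q01) => s _; apply: le_trans.
have rW : r <= a * W.
  rewrite -(@ler_pXn2r _ 2) ?nnegrE// ?mulr_ge0//; last exact: ltW.
  rewrite r2 exprMn W2 [leRHS](_ : _ = N%:R * (2 * (L * (v * a ^+ 2)))); last by ring.
  by rewrite ler_peMr ?ltW//; lra.
have tW : (1 - a) * W <= N%:R * v * t.
  have h1 : 0 <= (1 - a) * W by rewrite mulr_ge0// ltW.
  have h2 : 0 <= N%:R * v * t by rewrite mulr_ge0// ltW.
  rewrite -(@ler_pXn2r _ 2) ?nnegrE// exprMn W2 [leRHS](_ : _ = N%:R * v * (N%:R * v * t ^+ 2)); last by ring.
  rewrite Nvt2 [leRHS](_ : _ = (1 - a) * (2 * L * (N%:R * v))); last by ring.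
  rewrite expr2 -mulrA ler_pM2l// ler_piMl//; last by lra.
  by rewrite !mulr_ge0// ltW.
have : (1 - a) * W * (1 - 2 * t) <= N%:R * v * t * (1 - 2 * t).
  by apply: ler_wpM2r tW; lra.
have : (1 - a) * W * (2 * t) <= (1 - a) * W * a.
  by rewrite ler_wpM2l// ?mulr_ge0//; lra.
have : 0 <= a ^+ 2 * W by rewrite mulr_ge0// sqr_ge0.
lra.
Qed.

End block_tail.

(** * Lower half of the law of the iterated logarithm *)

Section lil_lower.
Context d (T : measurableType d) (R : realType) (P : probability T R).
Variables (q : R) (e : nat -> T -> bool).
Hypotheses (q01 : 0 < q < 1) (me : measurable_bits e).
Hypothesis be : bernoulli_bits P q setT e.
Let q0 : 0 < q. Proof. by case/andP: q01. Qed.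
Let q1 : 0 < 1 - q. Proof. by rewrite subr_gt0; case/andP: q01. Qed.
Let v := q * (1 - q).
Let v0 : 0 < v. Proof. by rewrite mulr_gt0. Qed.

(** Controls the position at the start of a block: [lil_upper] for the flipped bits with [a = 1],
    where [(1 + 1)^2 = 4]. *)
Let lower_neg : {ae P, forall w, \forall n \near \oo,
  - (4 * Num.sqrt v * lil_scale R n) <= walk q (bits e n w)}.
Proof.
have q01' : 0 < 1 - q < 1 by rewrite q1/= gtrBl.
have h := @lil_upper _ _ _ P (1 - q) (flip_bits e) q01' (measurable_flip_bits me)
  (bernoulli_flip_bits be) 1 _.
apply: filterS (h _); last by rewrite ltr01 lexx.
move=> w; apply: filterS => n.
rewrite bits_flip walk_negb => wn; rewrite lerNl; apply: le_trans wn _.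
by rewrite /v subKr [(1 - q) * q]mulrC (_ : (1 + 1) ^+ 2 = 4)//; ring.
Qed.

(** With [L = ln (y k)] the bound of [block_lower] is of order [1 / k.+1], which dominates a
    logarithmic increment. The ratio of block ends is [B^2], so the block has length
    [(1 - B^-2) b^(k+1)], and the root of [1 - B^-2] is at least [1 - B^-1]. *)
Let block_good (B : nat) (a : R) : 0 < a <= 3^-1 -> (1 < B)%N ->
  {ae P, forall w, forall k0, exists2 k, (k0 <= k)%N &
   (1 - 3 * a) * (1 - B%:R^-1) * (Num.sqrt v * lil_scale R ((B ^ 2) ^ k.+1)%N) <=
    walk q (bits e ((B ^ 2) ^ k.+1)%N w) - walk q (bits e ((B ^ 2) ^ k)%N w)}.
Proof.
move=> /andP[a0 a1] B1; have a01 : 0 < a <= 2^-1 by rewrite a0; lra.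
set b := (B ^ 2)%N.
have b1 : (1 < b)%N by rewrite /b; move: B1; case: (B) => [//|[//|B' _]].
have bR : 1 < b%:R :> R by rewrite ltr1n.
have bR0 : 0 < b%:R :> R by lra.
have lnb0 : 0 < ln (b%:R : R) by rewrite ln_gt0.
have bR2 : 2 <= b%:R :> R by rewrite ler_nat.
pose y k : R := k.+1%:R * ln (b%:R : R).
have yE k : ln ((b ^ k.+1)%N%:R : R) = y k by rewrite natrX lnXn// /y mulr_natl.
have va0 : 0 < v * a ^+ 2 by rewrite mulr_gt0// exprn_gt0.
(* The two summands secure the two conditions of [block_lower]: [L] large, and [2 L / (N v)] small,
   using [N >= y^2 / 8]. *)
pose Y0 := expR (8 / (v * a ^+ 2)) + 48 ^+ 2 / (v * a ^+ 2).
pose k1 := Num.truncn (Y0 / ln (b%:R : R)).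
have c0 : 0 < 3 / 4 / ln (b%:R : R) by rewrite divr_gt0.
have Mle : {homo (fun k => (b ^ k)%N) : m n / (m <= n)%N}.
  by move=> m n mn; rewrite leq_pexp2l// ltnW.
pose N k := (b ^ k.+1 - b ^ k)%N.
pose good k : pred (seq bool) := fun s =>
  (1 - 3 * a) * (Num.sqrt v * Num.sqrt (2 * (N k)%:R * ln (y k))) <= walk q s.
have N_ge k : (b ^ k.+1)%N%:R / 2 <= (N k)%:R :> R.
  rewrite natrB; last exact: Mle.
  have : (b ^ k)%N%:R * 2 <= (b ^ k.+1)%N%:R :> R.
    by rewrite expnSr natrM ler_wpM2l.
  lra.
have yY k : (k1 <= k)%N -> Y0 <= y k.
  move=> k1k; rewrite /y -ler_pdivrMr// ltW// (lt_le_trans (truncnS_gt _))//.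
  by rewrite ler_nat ltnS; exact: k1k.
have gP k : (k1 <= k)%N ->
    3 / 4 / ln (b%:R : R) * (ln k.+2%:R - ln k.+1%:R) <= bern q (N k) (good k).
  move=> /yY {}yY.
  have y0 : 0 < y k by apply: lt_le_trans yY; rewrite addr_gt0 ?expR_gt0// divr_gt0 ?exprn_gt0.
  have Y1 : expR (8 / (v * a ^+ 2)) <= y k.
    by apply: le_trans yY; rewrite lerDl ltW// divr_gt0 ?exprn_gt0.
  have Y2 : 48 ^+ 2 / (v * a ^+ 2) <= y k.
    by apply: le_trans yY; rewrite lerDr expR_ge0.
  have La : 8 / (v * a ^+ 2) <= ln (y k).
    by rewrite -[leLHS]expRK ler_ln ?posrE ?expR_gt0.
  have Ly : ln (y k) <= y k by rewrite (le_trans (ltW (ln_sublinear y0))).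
  have ey : (y k / 2) ^+ 2 <= (b ^ k.+1)%N%:R.
    have -> : (b ^ k.+1)%N%:R = expR (y k / 2) ^+ 2.
      rewrite -expRM_natl mulrC divfK// -yE lnK// posrE ltr0n expn_gt0.
      by rewrite ltnW.
    rewrite lerXn2r ?nnegrE ?expR_ge0 ?divr_ge0 ?ltW//.
    by have := expR_ge1Dx (y k / 2); lra.
  have NR : y k ^+ 2 / 8 <= (N k)%:R.
    by apply: le_trans (N_ge k); move: ey; rewrite exprMn; lra.
  have N0 : 0 < (N k)%:R :> R.
    by apply: lt_le_trans NR; rewrite divr_gt0// exprn_gt0.
  have LN : 2 * ln (y k) / ((N k)%:R * v) <= (a / 12) ^+ 2.
    rewrite ler_pdivrMr; last by rewrite mulr_gt0.
    apply: (@le_trans _ _ (2 * y k)); first by rewrite ler_pM2l.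
    apply: (@le_trans _ _ ((a / 12) ^+ 2 * (y k ^+ 2 / 8 * v))); last first.
      by rewrite ler_pM2l ?exprn_gt0 ?divr_gt0// ler_pM2r.
    rewrite [leRHS](_ : _ = y k * (y k * (v * a ^+ 2)) / (2 * (24 ^+ 2))); last by field.
    rewrite ler_pdivlMr ?mulr_gt0 ?exprn_gt0// mulrAC mulrC ler_pM2l//.
    by move: Y2; rewrite ler_pdivrMr// => Y2; apply: le_trans Y2; lra.
  have N0n : (0 < N k)%N by rewrite -(ltr0n R).
  apply: le_trans (block_lower q01 a01 N0n La LN); rewrite expRN lnK ?posrE//.
  rewrite -[leLHS]mulrA ler_pM2l//; apply: (@le_trans _ _ ((ln b%:R)^-1 * (k.+1%:R)^-1)).
    rewrite ler_pM2l ?invr_gt0// -ln_div ?posrE//.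
    have -> : k.+2%:R / k.+1%:R = 1 + k.+1%:R^-1 :> R.
      by rewrite -[k.+2%:R]natr1 mulrDl mul1r divff.
    by apply: le_ln1Dx; rewrite (lt_trans (ltrN10 _)).
  by rewrite /y invfM mulrC.
apply: filterS (block_borel_cantelli q01 me be Mle c0 gP) => w h k0.
have [k k0k gk] := h (maxn k0 k1).
exists k; first by rewrite (leq_trans _ k0k)// leq_maxl.
have -> : walk q (bits e (b ^ k.+1)%N w) - walk q (bits e (b ^ k)%N w) =
    walk q (drop (b ^ k)%N (bits e (b ^ k.+1)%N w)).
  rewrite -{1}(cat_take_drop (b ^ k)%N (bits e (b ^ k.+1)%N w)) take_bits; last exact: Mle.
  by rewrite /walk big_cat/= addrAC subrr add0r.
apply: le_trans gk; rewrite -mulrA ler_wpM2l//; first by lra.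
rewrite mulrCA ler_pM2l ?sqrtr_gt0// /lil_scale yE.
have L0 : 0 <= ln (y k).
  rewrite ln_ge0// (le_trans _ (yY k _))//; last by rewrite (leq_trans _ k0k)// leq_maxr.
  rewrite -[leLHS]addr0; apply: lerD; last by rewrite divr_ge0 ?sqr_ge0// ltW.
  by rewrite -[leLHS]expR0 ler_expR divr_ge0// ltW.
have BR : 1 < B%:R :> R by rewrite ltr1n.
have BV0 : 0 < (B%:R : R)^-1 by rewrite invr_gt0; lra.
have BV1 : (B%:R : R)^-1 <= 1 by rewrite invf_le1; lra.
rewrite -[X in X * _]ger0_norm; last by lra.
rewrite -sqrtr_sqr -sqrtrM ?sqr_ge0// ler_wsqrtr// mulrA ler_wpM2r//.
rewrite /N natrB; last exact: Mle.
have -> : (b ^ k)%N%:R = (b ^ k.+1)%N%:R * (B%:R^-1) ^+ 2 :> R.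
  have bE : b%:R = B%:R ^+ 2 :> R by rewrite natrX.
  rewrite expnSr natrM bE -mulrA -exprMn divff ?expr1n ?mulr1//.
  by rewrite gt_eqF//; lra.
set M := (b ^ k.+1)%N%:R; have M0 : 0 <= M by exact: ler0n.
rewrite -subr_ge0 (_ : _ - _ = 4 * (M * (B%:R^-1 * (1 - B%:R^-1)))); last by ring.
by rewrite !mulr_ge0//; lra.
Qed.

(** A good block adds nearly the full scale, and its starting point is at worst [-4 / B] times the
    scale at its end. *)
Lemma lil_lower (a : R) : 0 < a <= 1 ->
  {ae P, forall w, forall n0, exists2 n, (n0 <= n)%N &
    (1 - a) * Num.sqrt v * lil_scale R n <= walk q (bits e n w)}.
Proof.
move=> /andP[a0 a1].
(* With [a / 6] for the blocks and [1 / B <= a / 10], the loss is at most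
   [3 (a / 6) + 5 / B <= a]. *)
pose B := (Num.truncn (10 / a)).+2.
have Ba : 10 / a <= B%:R by rewrite ltW// (lt_trans (truncnS_gt _))// ltr_nat.
have a6 : 0 < a / 6 <= 3^-1 by rewrite divr_gt0//=; lra.
have B1 : (1 < B)%N by [].
have := block_good a6 B1; have := lower_neg.
apply: filterS2 => w [n1 _ n1P] h n0.
have [k kn hk] := h (maxn 1 (maxn n0 n1)).
have [k0 [k_n0 k_n1]] : (0 < k)%N /\ (n0 <= k)%N /\ (n1 <= k)%N.
  by move: kn; rewrite !geq_max => /and3P[].
set b := (B ^ 2)%N in hk.
have b1 : (1 < b)%N by [].
have kb j : (j <= b ^ j)%N by rewrite ltnW// ltn_expl.
exists (b ^ k.+1)%N; first by rewrite (leq_trans k_n0)// (leq_trans (leqnSn _)).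
have := n1P (b ^ k)%N (leq_trans k_n1 (kb k)) => /= hk'.
have B0 : 0 < B%:R :> R by rewrite ltr0n.
have scale : lil_scale R (b ^ k)%N <= B%:R^-1 * lil_scale R (b ^ k.+1)%N.
  rewrite /lil_scale -[X in _ <= X * _]gtr0_norm ?invr_gt0// -sqrtr_sqr -sqrtrM ?sqr_ge0//.
  rewrite ler_wsqrtr// [leRHS](_ : _ = 2 * (b ^ k)%N%:R * ln (ln (b ^ k.+1)%N%:R)); last first.
    have bE : b%:R = B%:R ^+ 2 :> R by rewrite natrX.
    set l := ln (ln (b ^ k.+1)%N%:R).
    rewrite expnSr natrM bE; field.
    by rewrite gt_eqF.
  have bk : 1 < (b ^ k)%N%:R :> R by rewrite ltr1n -{1}(exp1n k) ltn_exp2r.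
  have bk' : (b ^ k)%N%:R <= (b ^ k.+1)%N%:R :> R by rewrite ler_nat leq_exp2l.
  have bkp : 0 < (b ^ k)%N%:R :> R by lra.
  rewrite ler_wpM2l// ler_ln ?posrE ?ln_gt0//; last by lra.
  by rewrite ler_ln ?posrE//; lra.
have sv : 0 < Num.sqrt v by rewrite sqrtr_gt0.
have s0 : 0 <= lil_scale R (b ^ k.+1)%N by rewrite sqrtr_ge0.
have BV : B%:R^-1 <= a / 10 by rewrite -invf_div lef_pV2 ?posrE ?divr_gt0.
have BV0 : 0 < (B%:R : R)^-1 by rewrite invr_gt0.
move: hk hk'; set Z := Num.sqrt v * _; set w1 := walk q _; set w0 := walk q _ => hk hk'.
have Z0 : 0 <= Z by rewrite mulr_ge0.
have h1 : Num.sqrt v * lil_scale R (b ^ k)%N <= B%:R^-1 * Z.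
  by rewrite /Z mulrCA ler_pM2l.
have h2 : B%:R^-1 * Z <= a / 10 * Z by rewrite ler_wpM2r.
have h3 : 0 <= a * (B%:R^-1 * Z) by rewrite !mulr_ge0// ltW.
rewrite -mulrA -/Z; move: hk hk' h1 h2 h3.
set c := B%:R^-1; set x := lil_scale _ _; set r := Num.sqrt v.
clearbody Z w1 w0 c x r; lra.
Qed.
End lil_lower.

(** * The elephant walk *)

Section independence.
Context d (T : measurableType d) (R : realType) (P : probability T R).

Lemma mutual_independence_seq (I : choiceType) (F : I -> set (set T)) (E : I -> set T) (s : seq I) :
  mutual_independence P F -> uniq s -> (forall i, i \in s -> F i (E i)) ->
  P (\bigcap_(i in [set` s]) E i) = (\prod_(i <- s) P (E i))%E.
Proof.
move=> [_ indep] us FE.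
have mem i : (i \in [fset x in s]%fset) = (i \in s) by rewrite inE.
have <- : \bigcap_(i in [set` [fset x in s]%fset]) E i = \bigcap_(i in [set` s]) E i.
  by apply: eq_bigcapl; split => i /=; rewrite mem.
rewrite indep; last by move=> i; rewrite mem; exact: FE.
by apply: perm_big; apply: uniq_perm.
Qed.

Lemma bits_eqP (e : nat -> T -> bool) (s : seq bool) w :
  bits e (size s) w = s <-> forall i, (i < size s)%N -> e i w = nth false s i.
Proof.
split=> [<- i|h]; first by rewrite size_bits => ils; rewrite nth_mkseq.
by apply: (@eq_from_nth _ false); rewrite size_bits// => i si; rewrite nth_mkseq// h.
Qed.

Lemma preimage_in_sigma d' (T' : measurableType d') (f : T -> T') (A : set T') :
  measurable A -> g_sigma_algebra_preimage f (f @^-1` A).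
Proof. by move=> mA; exists A => //; rewrite setTI. Qed.

Lemma setT_in_sigma d' (T' : measurableType d') (f : T -> T') :
  g_sigma_algebra_preimage f [set: T].
Proof. by rewrite -(preimage_setT f); exact: preimage_in_sigma. Qed.

Lemma measurable_agreement (e k : nat -> T -> bool) :
  measurable_bits e -> measurable_bits k -> measurable_bits (fun i w => e i w == k i w).
Proof.
move=> me mk i; rewrite (_ : [set w | _] = ([set w | e i w] `&` [set w | k i w]) `|`
    (~` [set w | e i w] `&` ~` [set w | k i w])).
  by apply: measurableU; apply: measurableI => //; exact: measurableC.
apply/seteqP; split => w /=.
  by case: (e i w) (k i w) => [] []// _; [left|right].
by move=> [[-> ->//]|[/negP/negbTE-> /negP/negbTE->]].
Qed.

(* Conditionally on all the [e i], the [k i] are fair coins; hence so are the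
   comparisons of [e i] with [k i], whatever the law of [e]. *)
Lemma fair_agreement (C : set T) (e k : nat -> T -> bool) :
  measurable C -> measurable_bits e -> measurable_bits k ->
  (forall s t : seq bool, size s = size t ->
    P (C `&` [set w | bits e (size s) w = s] `&` [set w | bits k (size t) w = t]) =
    (P (C `&` [set w | bits e (size s) w = s]) * (2^-1 ^+ size t)%:E)%E) ->
  bernoulli_bits P 2^-1 C (fun i w => e i w == k i w).
Proof.
move=> mC me mk h t.
pose ek i w := e i w == k i w.
have meas_eq (f : nat -> T -> bool) (u : seq bool) : measurable_bits f ->
    measurable [set w | bits f (size u) w = u].
  move=> mf; rewrite (_ : [set _ | _] = [set w | bits f (size u) w == u]).
    exact: (@measurable_bits_pred _ _ f _ (fun t => t == u)).
  by apply/seteqP; split => w /= /eqP.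
have mek : measurable_bits ek by exact: measurable_agreement.
have -> : bit_weight 2^-1 t = 2^-1 ^+ size t :> R.
  rewrite /bit_weight (eq_bigr (fun=> 2^-1)); last first.
    by move=> b _; rewrite (_ : 1 - 2^-1 = 2^-1) ?if_same//; field.
  by rewrite big_const_seq count_predT; elim: (size t) => //= n ->; rewrite exprS.
(* Induction on the number [m] of bits of [e] not yet fixed. At [m = 0] the agreement word [t]
   determines the word [u] of [k], and the hypothesis on [k] applies. *)
suff H m (s : seq bool) : (size s + m = size t)%N ->
   P (C `&` [set w | bits e (size s) w = s] `&` [set w | bits ek (size t) w = t]) =
    (P (C `&` [set w | bits e (size s) w = s]) * (2^-1 ^+ size t)%:E)%E.
  have := H (size t) [::] erefl; rewrite (_ : [set w | bits e _ w = [::]] = setT) ?setIT//.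
  by apply/seteqP; split.
elim: m s => [|m IH] s.
  rewrite addn0 => st.
  pose u := mkseq (fun i => nth false s i == nth false t i) (size t).
  have su : size u = size t by rewrite size_mkseq.
  rewrite -su -(h s u); last by rewrite su.
  congr (P _); apply/seteqP; split => w /= [[Cw ws] h2]; split => //;
    have ew i : (i < size t)%N -> e i w = nth false s i by move/bits_eqP: ws => ws it; rewrite ws// st.
  - apply/bits_eqP => i; rewrite su => it; rewrite nth_mkseq// -(ew _ it).
    rewrite su in h2; move/bits_eqP: h2 => /(_ _ it) <-; rewrite /ek.
    by case: (e i w) (k i w) => [] [].
  - rewrite su; apply/bits_eqP => i it; have /bits_eqP/(_ i) := h2; rewrite su => /(_ it).
    by rewrite nth_mkseq// /ek (ew _ it) => ->; case: (nth _ s i) (nth _ t i) => [] [].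
move=> sm.
have split_s (D : set T) : measurable D ->
  P (C `&` [set w | bits e (size s) w = s] `&` D) =
  (P (C `&` [set w | bits e (size (rcons s true)) w = rcons s true] `&` D) +
   P (C `&` [set w | bits e (size (rcons s false)) w = rcons s false] `&` D))%E.
  move=> mD; have mm b : measurable (C `&` [set w | bits e (size (rcons s b)) w = rcons s b] `&` D).
    by apply: measurableI => //; apply: measurableI => //; exact: meas_eq.
  rewrite -(measureU P (mm true) (mm false)); last first.
    apply/seteqP; split => // w [] [[_ /= h1] _] [[_ /= h2] _].
    by move: h1 h2; rewrite !size_rcons => -> /rcons_inj[].
  congr (P _); apply/seteqP; split => w /=; rewrite !size_rcons.
    move=> [[Cw ws] Dw]; case ew : (e (size s) w); [left|right];
      by split => //; split => //; rewrite bitsS ws ew.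
  by move=> [|] [[Cw]]; rewrite bitsS => /rcons_inj [ws _] Dw.
have IHb b : P (C `&` [set w | bits e (size (rcons s b)) w = rcons s b]
     `&` [set w | bits ek (size t) w = t]) =
  (P (C `&` [set w | bits e (size (rcons s b)) w = rcons s b]) * (2^-1 ^+ size t)%:E)%E.
  by apply: IH; rewrite size_rcons addSn -addnS.
have split_T := split_s _ measurableT; rewrite !setIT in split_T.
apply: (eq_trans (split_s _ (meas_eq _ _ mek))).
apply: (eq_trans (f_equal2 +%E (IHb true) (IHb false))).
rewrite -muleDl//; first by apply/esym; apply: (f_equal2 *%E split_T).
by apply: ge0_adde_def; rewrite inE.
Qed.

End independence.

(** * Sign choices and recalled indices as bits *)

Section memory_bits.
Context d (T : measurableType d) (R : realType) (P : probability T R).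
Variables (p : R) (X : nat -> {RV P >-> R}).
Variables (B : nat -> {RV P >-> bool}) (K : nat -> {RV P >-> nat}).
Hypothesis B_law : forall n, (1 <= n)%N ->
  P [set w | B n w = true] = p%:E /\ P [set w | B n w = false] = (1 - p)%:E.
Hypothesis K_law : forall n, (2 <= n)%N ->
  P [set w | K n w = 1%N] = (2^-1)%:E /\ P [set w | K n w = 2%N] = (2^-1)%:E.

Let family (i : option (nat + nat)) : set (set T) :=
  match i with
  | None => g_sigma_algebra_preimage (X 1%N)
  | Some (inl n) => g_sigma_algebra_preimage (B n.+1)
  | Some (inr n) => g_sigma_algebra_preimage (K n.+2)
  end.
Hypothesis indep : mutual_independence P family.

(** Bit [i] drives the step [X i.+3], the first step with a random recall being [X 3]. If
    [X 2 = - X 1], that step equals [X 1] exactly when step 1 is kept or step 2 is reversed, that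
    is, when [relative_bit] holds. *)
Definition keep_bit (i : nat) (w : T) : bool := B i.+2 w.
Definition recall_bit (i : nat) (w : T) : bool := K i.+2 w == 1%N.
Definition relative_bit (i : nat) (w : T) : bool := keep_bit i w == recall_bit i w.

Lemma measurable_keep_bit : measurable_bits keep_bit.
Proof.
move=> i; rewrite (_ : [set w | _] = B i.+2 @^-1` [set true]).
  by rewrite -[_ @^-1` _]setTI; exact: measurable_funPT.
by apply/seteqP; split.
Qed.

Lemma measurable_recall_bit : measurable_bits recall_bit.
Proof.
move=> i; rewrite (_ : [set w | _] = K i.+2 @^-1` [set 1%N]).
  by rewrite -[_ @^-1` _]setTI; exact: measurable_funPT.
by apply/seteqP; split => w /= /eqP.
Qed.

(** [A] concerns [X 1] and [D] the sign choice for [X 2]. All prescribed values are gathered in one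
    duplicate-free list of indices, to which mutual independence is applied once. *)
Lemma joint_law (A D : set T) (s t : seq bool) :
  family None A -> family (Some (inl 0%N)) D ->
  P (A `&` D `&` [set w | bits keep_bit (size s) w = s]
           `&` [set w | bits recall_bit (size t) w = t]) =
  (P A * P D * (bit_weight p s)%:E * (2^-1 ^+ size t)%:E)%E.
Proof.
move=> FA FD.
pose E (i : option (nat + nat)) : set T :=
  match i with
  | None => A
  | Some (inl 0) => D
  | Some (inl n.+1) => [set w | B n.+2 w = nth false s n]
  | Some (inr n) => [set w | (K n.+2 w == 1%N) = nth false t n]
  end.
pose il (n : nat) : option (nat + nat) := Some (inl n.+1).
pose ir (n : nat) : option (nat + nat) := Some (inr n).
pose l := None :: Some (inl 0%N) :: map il (iota 0 (size s)) ++ map ir (iota 0 (size t)).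
have ul : uniq l.
  rewrite /= !inE /= !mem_cat cat_uniq !map_inj_uniq ?iota_uniq//; last 2 first.
  - by move=> i j [].
  - by move=> i j [].
  rewrite !andbT /=; apply/and3P; split.
  - by apply/norP; split; apply/mapP => -[].
  - by apply/norP; split; apply/mapP => -[].
  - by apply/hasPn => _ /mapP[i _ ->]; apply/mapP => -[].
have FE i : i \in l -> family i (E i).
  case: i => [[[|n]|n]|] _ //=.
  - rewrite (_ : [set w | _] = B n.+2 @^-1` [set nth false s n]); last by apply/seteqP; split.
    exact: preimage_in_sigma.
  - rewrite (_ : [set w | _] = K n.+2 @^-1` [set k | (k == 1%N) = nth false t n]); last by apply/seteqP; split.
    exact: preimage_in_sigma.
transitivity (P (\bigcap_(i in [set` l]) E i)).
  congr (P _); apply/seteqP; split => w.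
    move=> [[[Aw Dw] /= /bits_eqP ws] /bits_eqP wt] i /=.
    rewrite !inE mem_cat => /orP[/eqP->//|/orP[/eqP->//|/orP[]/mapP[n]]].
      by rewrite mem_iota add0n => /andP[_ ns] ->; exact: ws.
    by rewrite mem_iota add0n => /andP[_ nt] ->; exact: wt.
  move=> h; split; [split; [split|]|].
  - exact: (h None (mem_head _ _)).
  - by apply: (h (Some (inl 0%N))); rewrite /= !inE eqxx orbT.
  - apply/bits_eqP => i si; apply: (h (il i)).
    by rewrite /= !inE mem_cat map_f ?orbT// mem_iota.
  - apply/bits_eqP => i si; apply: (h (ir i)).
    by rewrite /= !inE mem_cat (map_f ir) ?orbT// mem_iota.
rewrite (mutual_independence_seq indep ul FE) /l !big_cons big_cat/= !big_map !muleA.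
congr (_ * _ * _)%E.
  rewrite /bit_weight (big_nth false) (big_morph EFin (@EFinM R) (erefl 1%:E)).
  rewrite /index_iota subn0 big_seq [RHS]big_seq; apply: eq_bigr => i _ /=.
  by case: nth; [exact: (B_law (ltn0Sn i.+1)).1|exact: (B_law (ltn0Sn i.+1)).2].
rewrite (_ : \prod_(i <- _) _ = \prod_(i <- iota 0 (size t)) (2^-1)%:E)%E; last first.
  apply: eq_bigr => i _ /=; have [K1 _] := K_law (isT : (2 <= i.+2)%N).
  have mK : measurable [set w | K i.+2 w = 1%N].
    rewrite (_ : [set w | _] = K i.+2 @^-1` [set 1%N]); last by apply/seteqP; split.
    by rewrite -[_ @^-1` _]setTI; exact: measurable_funPT.
  case: (nth _ t i).
    by rewrite -K1; congr (P _); apply/seteqP; split => w /= /eqP.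
  rewrite (_ : [set w | _] = ~` [set w | K i.+2 w = 1%N]).
    by rewrite probability_setC// K1 -EFinB; congr EFin; field.
  by apply/seteqP; split => w /=; [move/negbT/eqP|move/eqP/negbTE].
rewrite -(big_morph EFin (@EFinM R) (erefl 1%:E)) big_const_seq count_predT size_iota.
by congr EFin; elim: (size t) => //= n ->; rewrite exprS.
Qed.

Lemma keep_bits_bernoulli (A D : set T) : family None A -> family (Some (inl 0%N)) D ->
  bernoulli_bits P p (A `&` D) keep_bit.
Proof.
move=> FA FD s.
have e0 (f : nat -> T -> bool) : [set w | bits f (size (@nil bool)) w = [::]] = setT.
  by apply/seteqP; split.
have h0 := joint_law [::] [::] FA FD; have h := joint_law s [::] FA FD.
rewrite !e0 !setIT /bit_weight big_nil expr0 !mule1 in h0.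
by rewrite e0 !setIT expr0 mule1 in h; rewrite h h0.
Qed.

Lemma relative_bits_bernoulli (A D : set T) : family None A -> family (Some (inl 0%N)) D ->
  bernoulli_bits P 2^-1 (A `&` D) relative_bit.
Proof.
move=> FA FD; apply: fair_agreement.
- by apply: measurableI; [apply: (indep.1 None)|apply: (indep.1 (Some (inl 0%N)))].
- exact: measurable_keep_bit.
- exact: measurable_recall_bit.
move=> s t _; rewrite joint_law//; congr (_ * _)%E.
have h := joint_law s [::] FA FD.
rewrite (_ : [set w | bits recall_bit _ w = [::]] = setT) ?setIT ?expr0 ?mule1 in h.
  by rewrite h.
by apply/seteqP; split.
Qed.

Lemma measurable_relative_bit : measurable_bits relative_bit.
Proof. exact: measurable_agreement measurable_keep_bit measurable_recall_bit. Qed.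

End memory_bits.

(** * Deterministic limits at the iterated-logarithm scale *)

Section lil_deterministic.
Context (R : realType).

Lemma limn_esup_EFin (u : nat -> R) (l : R) :
  (forall eps, 0 < eps -> \forall n \near \oo, u n <= l + eps) ->
  (forall eps, 0 < eps -> forall N, exists2 n, (N <= n)%N & l - eps <= u n) ->
  limn_esup (fun n => (u n)%:E) = l%:E.
Proof.
move=> up lo; apply/eqP; rewrite eq_le; apply/andP; split.
  apply/lee_addgt0Pr => eps eps0; have uV := up _ eps0.
  apply: ge_ereal_inf; exists (ereal_sup ((fun n => (u n)%:E) @` [set n | u n <= l + eps])).
    by exists [set n | u n <= l + eps].
  by apply: ge_ereal_sup => _ [n un <-]; rewrite lee_fin.
apply/lee_subgt0Pr => eps eps0.
apply: le_ereal_inf_tmp => _ [V [N _ NV] <-].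
have [n Nn un] := lo _ eps0 N.
apply: le_ereal_sup_tmp; exists (u n)%:E; last by rewrite lee_fin.
by exists n => //; exact: NV.
Qed.

Lemma lil_scale_cvgy : lil_scale R n @[n --> \oo] --> +oo.
Proof.
apply/cvgryPge => A; near=> n.
(* The double exponential ensures [ln (ln n) >= 1]. *)
have nA : A ^+ 2 + expR (expR (1 : R)) <= n%:R by near: n; exact: nbhs_infty_ger.
have n1 : expR (expR (1 : R)) <= n%:R by apply: le_trans nA; rewrite lerDr sqr_ge0.
have n0 : 0 < (n%:R : R) by apply: lt_le_trans n1; exact: expR_gt0.
have l1 : expR (1 : R) <= ln (n%:R : R) by rewrite -[leLHS]expRK ler_ln ?posrE ?expR_gt0.
have l0 : 0 < ln (n%:R : R) by apply: lt_le_trans l1; exact: expR_gt0.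
have l2 : 1 <= ln (ln (n%:R : R)) by rewrite -[leLHS]expRK ler_ln ?posrE ?expR_gt0.
apply: le_trans (ler_norm _) _; rewrite -sqrtr_sqr ler_wsqrtr//.
apply: (@le_trans _ _ n%:R).
  by apply: le_trans nA; rewrite lerDl expR_ge0.
rewrite -[leLHS]mulr1; apply: ler_pM => //.
by rewrite ler_peMl ?(ltW n0)// ler1n.
Unshelve. all: by end_near. Qed.

(** With [t] the fourth root of [n], [ln (ln n) <= ln n <= 2 t^2]; hence the scale is at most
    [2 t^3], and the quotient at most [2 / t]. *)
Lemma lil_scale_div_cvg0 : lil_scale R n / n%:R @[n --> \oo] --> (0 : R).
Proof.
have sV : 2 * Num.sqrt (Num.sqrt (n%:R : R)^-1) @[n --> \oo] --> (0 : R).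
  have h := cvg_comp _ _ (@sqrt_natV_cvg0 R) (@sqrt_continuous R 0); rewrite sqrtr0 in h.
  by rewrite -(mulr0 2); apply: cvgMr.
apply: (squeeze_cvgr _ (cvg_cst (0 : R)) sV).
near=> n.
have n1 : (3 <= n)%N by near: n; exact: nbhs_infty_ge.
have n0 : 0 < (n%:R : R) by rewrite ltr0n (leq_trans _ n1).
rewrite divr_ge0 ?sqrtr_ge0//=.
rewrite ler_pdivrMr//.
set t := Num.sqrt (Num.sqrt (n%:R : R)).
have t0 : 0 < t by rewrite !sqrtr_gt0.
have t4 : t ^+ 4 = n%:R.
  by rewrite (exprM _ 2 2) !sqr_sqrtr ?sqrtr_ge0// ltW.
rewrite !sqrtrV ?sqrtr_ge0 ?(ltW n0)// -/t -t4.
have -> : 2 * t^-1 * t ^+ 4 = 2 * t ^+ 3 by field; rewrite gt_eqF.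
rewrite -[leRHS]ger0_norm; last by rewrite mulr_ge0// exprn_ge0// ltW.
rewrite -sqrtr_sqr ler_wsqrtr//.
have l0 : 0 < ln (n%:R : R) by rewrite ln_gt0// ltr1n (leq_trans _ n1).
have ll : ln (ln (n%:R : R)) <= ln n%:R by rewrite ltW// ln_sublinear.
have l2 : ln (n%:R : R) <= 2 * t ^+ 2.
  rewrite -t4 (exprM _ 2 2) lnXn ?exprn_gt0// [leRHS]mulr_natl lerMn2r/=.
  by rewrite ltW// ln_sublinear// exprn_gt0.
rewrite [leRHS](_ : _ = 2 * n%:R * (2 * t ^+ 2)); last by rewrite -t4; ring.
by rewrite ler_pM2l ?mulr_gt0//; exact: le_trans ll l2.
Unshelve. all: by end_near. Qed.

(** The bounded error [C] is negligible against the scale, which tends to infinity. *)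
Lemma limsup_lil_scale (Y Z : nat -> R) (r C : R) : 0 < r -> 0 <= C ->
  (\forall n \near \oo, `|Y n - 2 * Z n| <= C) ->
  (forall m, \forall n \near \oo, Z n <= (1 + m.+1%:R^-1) ^+ 2 * r * lil_scale R n) ->
  (forall m N, exists2 n, (N <= n)%N & (1 - m.+1%:R^-1) * r * lil_scale R n <= Z n) ->
  limn_esup (fun n => (Y n / lil_scale R n)%:E) = (2 * r)%:E.
Proof.
move=> r0 C0 YZ up lo.
(* 6 because [2 ((1 + a)^2 - 1) = 4 a + 2 a^2 <= 6 a] for [a <= 1]. *)
have pick eps : 0 < eps -> exists m : nat, 6 * (m.+1%:R^-1 * r) <= eps.
  move=> eps0; exists (Num.truncn (6 * r / eps)); rewrite mulrCA ler_pdivrMl//.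
  by rewrite -ler_pdivrMr// ltW// truncnS_gt.
have big eps : 0 < eps -> \forall n \near \oo, 0 < lil_scale R n /\ C <= eps * lil_scale R n.
  move=> eps0; near=> n.
  have sn : C / eps + 1 <= lil_scale R n.
    by near: n; have /cvgryPge := lil_scale_cvgy; exact.
  have Ce : 0 <= C / eps by rewrite divr_ge0// ltW.
  split; first by lra.
  by rewrite mulrC -ler_pdivrMr//; lra.
apply: limn_esup_EFin => eps eps0.
  have e2 : 0 < eps / 2 by rewrite divr_gt0.
  have [m mP] := pick _ e2.
  near=> n.
  have [s0 Cs] : 0 < lil_scale R n /\ C <= eps / 2 * lil_scale R n by near: n; exact: big.
  rewrite ler_pdivrMr//.
  have : `|Y n - 2 * Z n| <= C by near: n.
  rewrite ler_norml => /andP[_ h1].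
  have h2 : Z n <= (1 + m.+1%:R^-1) ^+ 2 * r * lil_scale R n by near: n; exact: up.
  have m1 : m.+1%:R^-1 <= 1 :> R by rewrite invf_le1// ler1n.
  have m0 : 0 < m.+1%:R^-1 :> R by rewrite invr_gt0.
  move: h1 h2 mP Cs s0 m1 m0; set a := m.+1%:R^-1; set s := lil_scale R n.
  set y := Y n; set z := Z n => h1 h2 mP Cs s0 m1 m0.
  have h3 : 6 * (a * r) * s <= eps / 2 * s by rewrite ler_pM2r.
  have h4 : a * (a * r * s) <= a * r * s by rewrite ler_piMl// !mulr_ge0// ltW.
  clear mP; lra.
move=> N; have e2 : 0 < eps / 2 by rewrite divr_gt0.
have [m mP] := pick _ e2.
have [N1 _ N1P] := YZ; have [N2 _ N2P] := big _ e2.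
have [n] := lo m (maxn N (maxn N1 N2)).
rewrite !geq_max => /and3P[Nn N1n N2n] h2; exists n => //.
have [s0 Cs] := N2P n N2n; rewrite ler_pdivlMr//.
have := N1P n N1n; rewrite /= ler_norml => /andP[h1 _].
have m0 : 0 < m.+1%:R^-1 :> R by rewrite invr_gt0.
move: h1 h2 mP Cs s0 m0; set a := m.+1%:R^-1; set s := lil_scale R n.
set y := Y n; set z := Z n => h1 h2 mP Cs s0 m0.
have h3 : 6 * (a * r) * s <= eps / 2 * s by rewrite ler_pM2r.
have h4 : 0 <= a * r * s by rewrite !mulr_ge0// ltW.
clear mP; lra.
Unshelve. all: by end_near. Qed.

End lil_deterministic.

(** * Pathwise reduction of the elephant walk to a Bernoulli walk *)

Section decomposition.
Context d (T : measurableType d) (R : realType) (P : probability T R).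
Variables (p : R) (X : nat -> {RV P >-> R}).
Variables (B : nat -> {RV P >-> bool}) (K : nat -> {RV P >-> nat}).

(* On [X_1 X_2 = 1] the centred steps are [2 X_1 (keep_bit - p)], and on
   [X_1 X_2 = -1] they are [2 X_1 (relative_bit - 1/2)]. *)
Definition path_bias (b : bool) : R := if b then p else 2^-1.
Definition path_bit (b : bool) := if b then keep_bit B else relative_bit B K.

Lemma walk_bitsS (q : R) (e : nat -> T -> bool) n w :
  walk q (bits e n.+1 w) = walk q (bits e n w) + ((e n w)%:R - q).
Proof. by rewrite bitsS -cats1 /walk big_cat big_seq1. Qed.

(** From time 2 on the increments agree exactly. The error 8 is 4 for the centred position at time
    2, plus 4 for the two surplus bits of a word of length [n]. *)
Lemma centered_position_walk w (n : nat) : 0 < p < 1 ->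
  X 1%N w = 1 \/ X 1%N w = -1 ->
  X 2 w = (if B 1%N w then X 1%N w else - X 1%N w) ->
  (forall n, (2 <= n)%N -> X n.+1 w = if B n w then X (K n w) w else - X (K n w) w) ->
  (forall n, (2 <= n)%N -> K n w = 1%N \/ K n w = 2) ->
  (2 <= n)%N ->
  `|centered_position p X n w -
    2 * (X 1%N w * walk (path_bias (B 1%N w)) (bits (path_bit (B 1%N w)) n w))| <= 8.
Proof.
move=> /andP[p0 p1] X1 X2 Xn Kn; case: n => [//|[//|n]] _.
set b := B 1%N w in X2 *; set q := path_bias b; set e := path_bit b.
have posS m : position X m.+1 w = position X m w + X m.+1 w.
  by rewrite /position big_nat_recr.
have E m : centered_position p X m.+2 w =
    centered_position p X 2 w + 2 * (X 1%N w * walk q (bits e m w)).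
  elim: m => [|m IH]; first by rewrite /bits/= walk_nil !mulr0 addr0.
  rewrite walk_bitsS mulrDr mulrDr addrA -IH /centered_position [in LHS]posS -natr1.
  suff : X m.+3 w - (2 * p - 1) * (X 1%N w + X 2 w) / 2 = 2 * (X 1%N w * ((e m w)%:R - q)).
    by move=> <-; field.
  rewrite Xn// X2 /q /e /path_bias /path_bit /relative_bit /recall_bit /keep_bit.
  by case: (b) X2 => X2; rewrite ?X2; have [->|->] := Kn m.+2 isT; rewrite ?X2; case: (B m.+2 w) => /=; rewrite ?mulr1n ?mulr0n; field.
have q01 : 0 <= q <= 1 by rewrite /q /path_bias; case: (b); lra.
have bit01 m : `|(e m w)%:R - q| <= 1.
  by rewrite ler_norml; case: (e m w) => /=; rewrite ?mulr1n ?mulr0n; lra.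
have x1 : `|X 1%N w| = 1 by case: X1 => ->; rewrite ?normrN normr1.
have Y2 : `|centered_position p X 2 w| <= 4.
  rewrite /centered_position /position big_nat_recr//= big_nat1.
  rewrite (_ : _ - _ = 2 * (1 - p) * (X 1%N w + X 2 w)); last by field.
  rewrite normrM ger0_norm; last by lra.
  have : `|X 1%N w + X 2 w| <= 2.
    apply: le_trans (ler_normD _ _) _; rewrite X2 x1; case: (b); rewrite ?normrN x1; lra.
  have : 0 <= `|X 1%N w + X 2 w| by [].
  set z := `|_ + _|; nra.
rewrite E !walk_bitsS.
rewrite (_ : _ - _ = centered_position p X 2 w
   - 2 * (X 1%N w * (((e n w)%:R - q) + ((e n.+1 w)%:R - q)))); last by ring.
apply: le_trans (ler_normB _ _) _; rewrite !normrM x1 mul1r ger0_norm//.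
have := ler_normD ((e n w)%:R - q) ((e n.+1 w)%:R - q).
have := bit01 n; have := bit01 n.+1.
set u := `|_ - q|; set u' := `|_ - q|; set u'' := `|_ + _|; move: Y2; set y := `|_|.
clearbody u u' u'' y; lra.
Qed.

End decomposition.

Section walk_symmetry.
Context (R : realType).
Implicit Type q : R.

Lemma bern_negb q n (Q : pred (seq bool)) :
  bern (1 - q) n Q = bern q n (fun s => Q (map negb s)).
Proof. by elim: n Q => //= n IH Q; rewrite !IH subKr addrC. Qed.

(** For [x = -1], complementing the bits turns the negated walk into a walk of parameter [1 - q]
    with the same variance. *)
Lemma signed_walk_cvg q (x y : R) (c : nat -> R) : 0 < q < 1 -> x = 1 \/ x = -1 ->
  c n / Num.sqrt n%:R @[n --> \oo] --> y ->
  bern q n (fun s => 2 * (x * walk q s) <= c n) @[n --> \oo] -->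
  gcdf 1 (y / (2 * Num.sqrt (q * (1 - q)))).
Proof.
move=> q01 xE cy.
have c2 : c n / 2 / Num.sqrt n%:R @[n --> \oo] --> y / 2.
  have -> : (fun n => c n / 2 / Num.sqrt n%:R) = (fun n => c n / Num.sqrt n%:R / 2).
    by apply/funext => n; rewrite mulrAC.
  exact: cvgMl.
rewrite invfM mulrA; case: xE => ->.
  rewrite (_ : (fun n => _) = fun n => walk_cdf q n (c n / 2)).
    exact: de_moivre_laplace.
  apply/funext => n; apply: (eq_bern q01) => s _.
  by rewrite mul1r ler_pdivlMr// mulrC.
have q01' : 0 < 1 - q < 1.
  by case/andP: q01 => q0 q1; rewrite subr_gt0 q1 gtrBl.
rewrite (_ : (fun n => _) = fun n => walk_cdf (1 - q) n (c n / 2)).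
  by have := de_moivre_laplace q01' c2; rewrite subKr [(1 - q) * q]mulrC.
apply/funext => n; rewrite /walk_cdf bern_negb; apply: (eq_bern q01) => s _.
by rewrite walk_negb mulN1r ler_pdivlMr// mulrC.
Qed.

End walk_symmetry.

Section almost_everywhere.
Context d (T : measurableType d) (R : realType) (P : probability T R).

Lemma le_probability_ae (A A' : set T) : measurable A -> measurable A' ->
  {ae P, forall w, A w -> A' w} -> (P A <= P A')%E.
Proof.
move=> mA mA' [N [mN N0 AN]].
apply: (@le_trans _ _ (P (A' `|` N))).
  apply: le_measure; rewrite ?inE//; first exact: measurableU.
  move=> w Aw; case: (pselect (A' w)) => A'w; [by left|right].
  by apply: AN => /= /(_ Aw).
apply: le_trans (measureU2 P mA' mN) _.
by rewrite [X in (_ + X)%E](_ : _ = 0%E) ?adde0.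
Qed.

Lemma ae_setU (A A' : set T) (a : R) : measurable A -> measurable A' -> A `&` A' = set0 ->
  P A = a%:E -> P A' = (1 - a)%:E -> {ae P, forall w, A w \/ A' w}.
Proof.
move=> mA mA' AA' PA PA'; exists (~` (A `|` A')); split.
- by apply: measurableC; exact: measurableU.
- rewrite probability_setC; last exact: measurableU.
  rewrite (_ : P (A `|` A') = 1%:E) ?subee//.
  apply: (eq_trans (measureU P mA mA' AA')).
  by apply: (eq_trans (f_equal2 +%E PA PA')); rewrite -EFinD (addrC a) subrK.
- by move=> w /= h [|] ?; apply: h; [left|right].
Qed.

End almost_everywhere.

(** * The three limit theorems for the elephant walk *)

Section elephant_walk.
Context d (T : measurableType d) (R : realType) (P : probability T R).
Variables (p : R) (X : nat -> {RV P >-> R}).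
Hypotheses (p01 : 0 < p < 1)
  (X1_pos : P [set w | X 1%N w = 1] = p%:E)
  (X1_neg : P [set w | X 1%N w = -1] = (1 - p)%:E).
Variables (B : nat -> {RV P >-> bool}) (K : nat -> {RV P >-> nat}).
Hypothesis B_law : forall n, (1 <= n)%N ->
  P [set w | B n w = true] = p%:E /\ P [set w | B n w = false] = (1 - p)%:E.
Hypothesis K_law : forall n, (2 <= n)%N ->
  P [set w | K n w = 1%N] = (2^-1)%:E /\ P [set w | K n w = 2%N] = (2^-1)%:E.
Hypothesis indep : mutual_independence P (fun i : option (nat + nat) =>
  match i with
  | None => g_sigma_algebra_preimage (X 1%N)
  | Some (inl n) => g_sigma_algebra_preimage (B n.+1)
  | Some (inr n) => g_sigma_algebra_preimage (K n.+2)
  end).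
Hypothesis X2E : {ae P, forall w, X 2 w = if B 1%N w then X 1%N w else - X 1%N w}.
Hypothesis XnE : forall n, (2 <= n)%N -> {ae P, forall w,
  X n.+1 w = if B n w then X (K n w) w else - X (K n w) w}.

Local Notation bias := (path_bias p).
Local Notation bit := (path_bit B K).

Lemma path_bias01 b : 0 < bias b < 1.
Proof. by rewrite /path_bias; case: b => //; lra. Qed.

Lemma measurable_path_bit b : measurable_bits (bit b).
Proof.
rewrite /path_bit; case: b; first exact: measurable_keep_bit.
exact: measurable_relative_bit.
Qed.

Lemma path_bits_bernoulli b (A D : set T) :
  g_sigma_algebra_preimage (X 1%N) A -> g_sigma_algebra_preimage (B 1%N) D ->
  bernoulli_bits P (bias b) (A `&` D) (bit b).
Proof.
move=> FA FD; rewrite /path_bit /path_bias; case: b.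
  exact: (keep_bits_bernoulli B_law K_law indep).
exact: (relative_bits_bernoulli B_law K_law indep).
Qed.

Lemma measurable_RV_eq d' (T' : measurableType d') (Y : {RV P >-> T'}) (y : T') :
  measurable [set y] -> measurable [set w | Y w = y].
Proof.
move=> my; rewrite (_ : [set w | _] = Y @^-1` [set y]); last by apply/seteqP; split.
by rewrite -[_ @^-1` _]setTI; exact: measurable_funPT.
Qed.

Lemma X1_sign : {ae P, forall w, X 1%N w = 1 \/ X 1%N w = -1}.
Proof.
apply: (ae_setU _ _ _ X1_pos X1_neg).
- exact: measurable_RV_eq.
- exact: measurable_RV_eq.
- by apply/seteqP; split => // w [/= -> /eqP]; rewrite -subr_eq0 opprK gt_eqF.
Qed.

Lemma recall_index n : (2 <= n)%N -> {ae P, forall w, K n w = 1%N \/ K n w = 2}.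
Proof.
move=> n2; have [K1 K2] := K_law n2.
rewrite (_ : 2^-1 = 1 - 2^-1) in K2; last by field.
apply: (ae_setU _ _ _ K1 K2).
- exact: measurable_RV_eq.
- exact: measurable_RV_eq.
- by apply/seteqP; split => // w [/= ->].
Qed.

Lemma centered_position_walk_ae : {ae P, forall w, [/\ X 1%N w = 1 \/ X 1%N w = -1,
  X 2 w = (if B 1%N w then X 1%N w else - X 1%N w) &
  forall n, (2 <= n)%N -> `|centered_position p X n w -
    2 * (X 1%N w * walk (bias (B 1%N w)) (bits (bit (B 1%N w)) n w))| <= 8]}.
Proof.
have XA : {ae P, forall w, forall n, (2 <= n)%N ->
    X n.+1 w = if B n w then X (K n w) w else - X (K n w) w}.
  apply: ae_foralln => n; case: (leqP 2 n) => n2; last by apply: aeW.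
  by apply: filterS (XnE n2) => w Xw _.
have KA : {ae P, forall w, forall n, (2 <= n)%N -> K n w = 1%N \/ K n w = 2}.
  apply: ae_foralln => n; case: (leqP 2 n) => n2; last by apply: aeW.
  by apply: filterS (recall_index n2) => w Kw _.
have XK : {ae P, forall w, (forall n, (2 <= n)%N ->
    X n.+1 w = if B n w then X (K n w) w else - X (K n w) w) /\
    forall n, (2 <= n)%N -> K n w = 1%N \/ K n w = 2}.
  by move: XA KA; apply: filterS2 => w.
move: X1_sign X2E XK; apply: filterS3 => w X1 X2 [Xn Kn]; split => // n n2.
exact: (centered_position_walk p01 X1 X2 Xn Kn n2).
Qed.

(** Accuracies run over [1 / m.+1], so that countably many null sets are involved. *)
Definition lil_bounds (r : R) (Z : nat -> R) : Prop :=
  (forall m, \forall n \near \oo, Z n <= (1 + m.+1%:R^-1) ^+ 2 * r * lil_scale R n) /\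
  (forall m N, exists2 n, (N <= n)%N & (1 - m.+1%:R^-1) * r * lil_scale R n <= Z n).

Lemma lil_path b : {ae P, forall w, lil_bounds (Num.sqrt (bias b * (1 - bias b)))
  (fun n => walk (bias b) (bits (bit b) n w))}.
Proof.
have FA : g_sigma_algebra_preimage (X 1%N) setT by exact: setT_in_sigma.
have FD : g_sigma_algebra_preimage (B 1%N) setT by exact: setT_in_sigma.
have be := path_bits_bernoulli b FA FD; rewrite setIT in be.
have me := measurable_path_bit b; have q01 := path_bias01 b.
have m01 m : 0 < (m.+1%:R : R)^-1 <= 1 by rewrite invr_gt0 ltr0n invf_le1// ler1n.
have h1 := ae_foralln (fun m => lil_upper q01 me be (m01 m)).
have h2 := ae_foralln (fun m => lil_lower q01 me be (m01 m)).
by move: h1 h2; apply: filterS2 => w; split.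
Qed.

Lemma lil_path_opp b : {ae P, forall w, lil_bounds (Num.sqrt (bias b * (1 - bias b)))
  (fun n => - walk (bias b) (bits (bit b) n w))}.
Proof.
have FA : g_sigma_algebra_preimage (X 1%N) setT by exact: setT_in_sigma.
have FD : g_sigma_algebra_preimage (B 1%N) setT by exact: setT_in_sigma.
have be := path_bits_bernoulli b FA FD; rewrite setIT in be.
have be' := bernoulli_flip_bits be.
have me' := measurable_flip_bits (measurable_path_bit b).
have /andP[q0 q1] := path_bias01 b.
have q01' : 0 < 1 - bias b < 1 by rewrite subr_gt0 q1 gtrBl.
have m01 m : 0 < (m.+1%:R : R)^-1 <= 1 by rewrite invr_gt0 ltr0n invf_le1// ler1n.
have h1 := ae_foralln (fun m => lil_upper q01' me' be' (m01 m)).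
have h2 := ae_foralln (fun m => lil_lower q01' me' be' (m01 m)).
have vE : (1 - bias b) * (1 - (1 - bias b)) = bias b * (1 - bias b) by rewrite subKr mulrC.
move: h1 h2; apply: filterS2 => w; rewrite vE => u l; split => [m|m N].
  by apply: filterS (u m) => n; rewrite bits_flip walk_negb.
by have [n Nn] := l m N; rewrite bits_flip walk_negb => ?; exists n.
Qed.

(** Off one null set the bounds hold for both branches and both signs, so each [w] can select its
    branch [B 1 w] and its sign [X 1 w] pointwise. *)
Lemma lil_centered_position : {ae P, forall w,
  limn_esup (fun n => (centered_position p X n w / lil_scale R n)%:E)
    = (limit_deviation p X w)%:E /\
  limn_einf (fun n => (centered_position p X n w / lil_scale R n)%:E)
    = (- limit_deviation p X w)%:E}.
Proof.
pose r b := Num.sqrt (bias b * (1 - bias b)).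
have L : {ae P, forall w, forall b,
    lil_bounds (r b) (fun n => walk (bias b) (bits (bit b) n w)) /\
    lil_bounds (r b) (fun n => - walk (bias b) (bits (bit b) n w))}.
  have L b : {ae P, forall w,
      lil_bounds (r b) (fun n => walk (bias b) (bits (bit b) n w)) /\
      lil_bounds (r b) (fun n => - walk (bias b) (bits (bit b) n w))}.
    by move: (lil_path b) (lil_path_opp b); apply: filterS2.
  by move: (L true) (L false); apply: filterS2 => w ? ? [].
move: centered_position_walk_ae L; apply: filterS2 => w [X1 X2 Yw] Lw.
set b := B 1%N w in X2 Yw; have [W W'] := Lw b.
have /andP[q0 q1] := path_bias01 b.
have r0 : 0 < r b by rewrite sqrtr_gt0 mulr_gt0// subr_gt0.
(* The factor 2 comes from the steps [2 X_1 (bit - bias)]; for the fair branch it gives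
   [2 sqrt (1/4) = 1]. *)
have rE : limit_deviation p X w = 2 * r b.
  rewrite /limit_deviation X2 /r /bias; case: (b).
    rewrite (_ : X 1%N w * _ = 1) ?eqxx; last by case: X1 => ->; ring.
    rewrite -[2]ger0_norm// -sqrtr_sqr -sqrtrM ?sqr_ge0//; congr Num.sqrt; ring.
  rewrite (_ : X 1%N w * _ = -1); last by case: X1 => ->; ring.
  rewrite eq_sym -subr_eq0 opprK (_ : 1 + 1 == 0 = false); last by rewrite gt_eqF.
  rewrite (_ : 2^-1 * _ = 2^-1 ^+ 2); last by field.
  by rewrite sqrtr_sqr ger0_norm// divff.
pose Z n := X 1%N w * walk (bias b) (bits (bit b) n w).
have YZ : \forall n \near \oo, `|centered_position p X n w - 2 * Z n| <= 8.
  by near=> n; apply: Yw; near: n; exact: nbhs_infty_ge.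
have YZ' : \forall n \near \oo, `|(- centered_position p X n w) - 2 * (- Z n)| <= 8.
  by apply: filterS YZ => n; rewrite mulrN opprK -normrN opprD !opprK.
have c8 : 0 <= 8 :> R by [].
have [[uZ lZ] [uZ' lZ']] : lil_bounds (r b) Z /\ lil_bounds (r b) (fun n => - Z n).
  case: X1 => xE.
    have -> : Z = fun n => walk (bias b) (bits (bit b) n w); last by [].
    by apply/funext => n; rewrite /Z xE mul1r.
  have -> : Z = fun n => - walk (bias b) (bits (bit b) n w).
    by apply/funext => n; rewrite /Z xE mulN1r.
  split=> //; rewrite (_ : (fun n => _) = fun n => walk (bias b) (bits (bit b) n w))//.
  by apply/funext => n; rewrite opprK.
rewrite rE; split; first exact: limsup_lil_scale YZ uZ lZ.
rewrite /limn_einf.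
have -> : (\- (fun n => (centered_position p X n w / lil_scale R n)%:E))%E =
    (fun n => (- centered_position p X n w / lil_scale R n)%:E).
  by apply/funext => n /=; rewrite mulNr.
by rewrite (limsup_lil_scale r0 c8 YZ' uZ' lZ') EFinN.
Unshelve. all: by end_near. Qed.

(** Both branches are of the order of the iterated-logarithm scale, which is negligible against
    [n]. *)
Lemma lln_centered_position : {ae P, forall w,
  centered_position p X n w / n%:R @[n --> \oo] --> (0 : R)}.
Proof.
have L : {ae P, forall w, forall b, exists C,
    \forall n \near \oo, `|walk (bias b) (bits (bit b) n w)| <= C * lil_scale R n}.
  have L b : {ae P, forall w, exists C,
      \forall n \near \oo, `|walk (bias b) (bits (bit b) n w)| <= C * lil_scale R n}.
    move: (lil_path b) (lil_path_opp b); apply: filterS2 => w [u _] [u' _].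
    exists ((1 + 1%:R^-1) ^+ 2 * Num.sqrt (bias b * (1 - bias b))).
    near=> n; rewrite ler_norml lerNl; apply/andP.
    by split; near: n; [exact: u' 0|exact: u 0].
  by move: (L true) (L false); apply: filterS2 => w ? ? [].
move: centered_position_walk_ae L; apply: filterS2 => w [X1 X2 Yw] Lw.
set b := B 1%N w in X2 Yw; have [C CP] := Lw b.
have nV := @natV_cvg0 R.
have bnd : 2 * C * (lil_scale R n / n%:R) + 8 * n%:R^-1 @[n --> \oo] --> (0 : R).
  have h1 : 2 * C * (lil_scale R n / n%:R) @[n --> \oo] --> 2 * C * 0.
    by apply: cvgMr; exact: lil_scale_div_cvg0.
  have h2 : 8 * (n%:R : R)^-1 @[n --> \oo] --> 8 * (0 : R) by exact: cvgMr.
  have h3 : 2 * C * (lil_scale R n / n%:R) + 8 * (n%:R : R)^-1 @[n --> \oo] -->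
      2 * C * 0 + 8 * 0 by exact: cvgD.
  by rewrite !mulr0 addr0 in h3.
apply/norm_cvg0P; apply: (squeeze_cvgr _ (cvg_cst (0 : R)) bnd).
near=> n; rewrite normr_ge0/= normrM normfV (ger0_norm (ler0n R n)).
have n2 : (2 <= n)%N by near: n; exact: nbhs_infty_ge.
have n0 : 0 < (n%:R : R) by rewrite ltr0n (leq_trans _ n2).
rewrite ler_pdivrMr// mulrDl -[X in X + _]mulrA !mulfVK ?gt_eqF//.
have wC : `|walk (bias b) (bits (bit b) n w)| <= C * lil_scale R n by near: n.
have x1 : `|X 1%N w| = 1 by case: X1 => ->; rewrite ?normrN normr1.
have h := Yw _ n2.
rewrite -[X in `|X|](subrK (2 * (X 1%N w * walk (bias b) (bits (bit b) n w)))).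
apply: le_trans (ler_normD _ _) _; rewrite addrC; apply: lerD => //.
by rewrite !normrM x1 mul1r ger0_norm// -mulrA ler_pM2l.
Unshelve. all: by end_near. Qed.

(** The negative case is a complement, so that the four cells partition the whole space and not
    merely almost all of it. *)
Definition start_event (s : bool) : set T :=
  if s then [set w | X 1%N w = 1] else ~` [set w | X 1%N w = 1].
Definition start_sign (s : bool) : R := if s then 1 else -1.
Definition branch_event (b : bool) : set T := [set w | B 1%N w = b].
Definition keep_prob (b : bool) : R := if b then p else 1 - p.

Lemma measurable_start_event s : measurable (start_event s).
Proof.
by rewrite /start_event; case: s; [|apply: measurableC]; exact: measurable_RV_eq.
Qed.

Lemma measurable_branch_event b : measurable (branch_event b).
Proof. exact: measurable_RV_eq. Qed.

Lemma start_event_sigma s : g_sigma_algebra_preimage (X 1%N) (start_event s).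
Proof.
rewrite (_ : start_event s = X 1%N @^-1` (if s then [set 1] else ~` [set 1])).
  by apply: preimage_in_sigma; case: s => //; apply: measurableC.
by rewrite /start_event; case: s.
Qed.

Lemma branch_event_sigma b : g_sigma_algebra_preimage (B 1%N) (branch_event b).
Proof. by rewrite (_ : branch_event b = B 1%N @^-1` [set b])//; exact: preimage_in_sigma. Qed.

(** A cell depends only on [X 1] and [B 1], of which the bits of its branch are independent. *)
Lemma cell_law s b n (c : R) :
  P (start_event s `&` branch_event b `&`
     [set w | 2 * (start_sign s * walk (bias b) (bits (bit b) n w)) <= c]) =
  (keep_prob s * keep_prob b *
    bern (bias b) n (fun t => (2 * (start_sign s * walk (bias b) t) <= c)%R))%:E.
Proof.
have FA := start_event_sigma s; have FD := branch_event_sigma b.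
have mC : measurable (start_event s `&` branch_event b).
  by apply: measurableI; [exact: measurable_start_event|exact: measurable_branch_event].
rewrite (bernoulli_bits_law _ (fun t => 2 * (start_sign s * walk (bias b) t) <= c)
  mC (measurable_path_bit b) (path_bits_bernoulli b FA FD)).
rewrite EFinM; congr (_ * _)%E.
have := joint_law B_law K_law indep [::] [::] FA FD.
have e0 (f : nat -> T -> bool) : [set w | bits f (size (@nil bool)) w = [::]] = setT.
  by apply/seteqP; split.
rewrite !e0 !setIT /bit_weight big_nil expr0 !mule1 => ->; rewrite EFinM; congr (_ * _)%E.
  rewrite /start_event /keep_prob; case: s {FA mC} => //.
  rewrite probability_setC; last exact: measurable_RV_eq.
  by apply: (eq_trans (f_equal (fun x => 1 - x)%E X1_pos)).
by rewrite /branch_event /keep_prob; case: b {FD mC}; have [] := B_law (ltnSn 0).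
Qed.

Lemma probability_split (A E : set T) : measurable A -> measurable E ->
  P A = (P (E `&` A) + P (~` E `&` A))%E.
Proof.
move=> mA mE; rewrite -measureU; last 3 first.
- exact: measurableI.
- by apply: measurableI => //; exact: measurableC.
- by rewrite setIACA setICr set0I.
by congr (P _); rewrite -setIUl setUCr setTI.
Qed.

Lemma cell_partition (A : set T) : measurable A ->
  P A = (\sum_(s : bool) \sum_(b : bool) P (start_event s `&` branch_event b `&` A))%E.
Proof.
move=> mA.
have bE (D : set T) : measurable D -> P D = (\sum_(b : bool) P (branch_event b `&` D))%E.
  move=> mD; rewrite big_bool/= (probability_split mD (measurable_branch_event true)).
  congr (_ + P (_ `&` _))%E.
  by apply/seteqP; split => w; rewrite /branch_event/=; case: (B 1%N w).
rewrite (probability_split mA (measurable_start_event true)) big_bool/=.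
congr (_ + _)%E; rewrite bE; try (apply: eq_bigr => b _; by rewrite setICA setIA).
- by apply: measurableI => //; exact: (measurable_start_event true).
- by apply: measurableI => //; exact: (measurable_start_event false).
Qed.

(** On each of the four cells the probability is squeezed between two probabilities for the signed
    Bernoulli walk, at levels shifted by the error 8; after division by [sqrt n] the shift
    vanishes. *)
Lemma clt_centered_position :
  cvg_in_distribution
    (fun n => (Num.sqrt n%:R)^-1 \o* centered_position p X n : {RV P >-> R})
    (fun x => p%:E * normal_cdf (4 * p * (1 - p)) x + (1 - p)%:E * normal_cdf 1 x)%E.
Proof.
move=> y _.
pose W (c : nat -> R) n := \sum_(s : bool) \sum_(b : bool) (keep_prob s * keep_prob b *
  bern (bias b) n (fun t => 2 * (start_sign s * walk (bias b) t) <= c n)).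
have WE c n : (W c n)%:E = (\sum_(s : bool) \sum_(b : bool)
    P (start_event s `&` branch_event b `&`
      [set w | (2 * (start_sign s * walk (bias b) (bits (bit b) n w)) <= c n)%R]))%E.
  by rewrite /W !big_bool !EFinD !cell_law.
pose l := \sum_(s : bool) \sum_(b : bool) (keep_prob s * keep_prob b *
  gcdf 1 (y / (2 * Num.sqrt (bias b * (1 - bias b))))).
have Wl (C : R) : (W (fun n => y * Num.sqrt n%:R + C) n)%:E @[n --> \oo] --> l%:E.
  apply: cvg_EFin; first exact: nearW.
  have cy : (y * Num.sqrt n%:R + C) / Num.sqrt n%:R @[n --> \oo] --> y.
    have sV := @sqrt_natV_cvg0 R.
    have h : y + C * Num.sqrt (n%:R : R)^-1 @[n --> \oo] --> y + C * 0.
      by apply: cvgD; [exact: cvg_cst|exact: cvgMr].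
    rewrite mulr0 addr0 in h; apply: cvg_trans h; apply: near_eq_cvg; near=> n.
    have n0 : 0 < (n%:R : R) by rewrite ltr0n; near: n; exact: nbhs_infty_gt.
    by rewrite mulrDl mulfK ?gt_eqF ?sqrtr_gt0// sqrtrV// ltW.
  have sgn s : start_sign s = 1 \/ start_sign s = -1.
    by rewrite /start_sign; case: s; [left|right].
  have cvg_sb s b := signed_walk_cvg (path_bias01 b) (sgn s) cy.
  apply: cvg_big => [|s _]; first exact: add_continuous.
  apply: cvg_big => [|b _]; first exact: add_continuous.
  by apply: cvgMr; exact: cvg_sb.
(* The limit in a cell depends only on [b]; summing the weights over [s] gives 1 and leaves the
   mixture weight [keep_prob b]. *)
rewrite [X in _ --> X](_ : _ = l%:E); last first.
  have [p0 p1] := andP p01.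
  rewrite !normal_cdf_gcdf//; last by rewrite !mulr_gt0// subr_gt0.
  rewrite /l !big_bool/= /keep_prob /path_bias.
  rewrite (_ : 2 * Num.sqrt (p * (1 - p)) = Num.sqrt (4 * p * (1 - p))); last first.
    rewrite -{1}[2]ger0_norm// -sqrtr_sqr -sqrtrM ?sqr_ge0//; congr Num.sqrt; ring.
  rewrite (_ : 2 * Num.sqrt (2^-1 * (1 - 2^-1)) = Num.sqrt 1); last first.
    by rewrite -{1}[2]ger0_norm// -sqrtr_sqr -sqrtrM ?sqr_ge0//; congr Num.sqrt; field.
  by rewrite -!EFinM -EFinD; congr EFin; ring.
apply: (squeeze_cvge _ (Wl (- 8)) (Wl 8)).
near=> n.
have n2 : (2 <= n)%N by near: n; exact: nbhs_infty_ge.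
have n0 : 0 < (n%:R : R) by rewrite ltr0n (leq_trans _ n2).
set A := (X in (_ <= cdf X _ <= _)%E).
have preA : A @^-1` `]-oo, y] = [set w | centered_position p X n w <= y * Num.sqrt n%:R].
  by apply/seteqP; split => w /=; rewrite in_itv/= ler_pdivrMr// sqrtr_gt0.
have cdfE : @cdf _ _ _ P A y = P [set w | centered_position p X n w <= y * Num.sqrt n%:R].
  by rewrite -preA.
have mA : measurable [set w | centered_position p X n w <= y * Num.sqrt n%:R].
  rewrite (_ : [set w | _] = centered_position p X n @^-1` `]-oo, y * Num.sqrt n%:R]).
    by rewrite -[_ @^-1` _]setTI; exact: measurable_funPT.
  by apply/seteqP; split => w /=; rewrite in_itv.
have mW s b (c : R) : measurable (start_event s `&` branch_event b `&`
      [set w | 2 * (start_sign s * walk (bias b) (bits (bit b) n w)) <= c]).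
  apply: measurableI.
    by apply: measurableI; [exact: measurable_start_event|exact: measurable_branch_event].
  exact: (measurable_bits_pred n (fun t => 2 * (start_sign s * walk (bias b) t) <= c)
    (measurable_path_bit b)).
have mAc s b : measurable (start_event s `&` branch_event b `&`
      [set w | centered_position p X n w <= y * Num.sqrt n%:R]).
  apply: measurableI => //.
  by apply: measurableI; [exact: measurable_start_event|exact: measurable_branch_event].
have sE s w : X 1%N w = 1 \/ X 1%N w = -1 -> start_event s w -> X 1%N w = start_sign s.
  by rewrite /start_event /start_sign; case: s => /= -[].
rewrite cdfE (cell_partition mA) !WE; apply/andP; split.
- apply: lee_sum => s _; apply: lee_sum => b _; apply: le_probability_ae => //.
  apply: filterS centered_position_walk_ae => w [X1 _ /(_ _ n2) Yw] [[sw bw] /= h].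
  split => //; rewrite bw (sE _ _ X1 sw) in Yw.
  by move: Yw; rewrite ler_norml => /andP[_]; lra.
- apply: lee_sum => s _; apply: lee_sum => b _; apply: le_probability_ae => //.
  apply: filterS centered_position_walk_ae => w [X1 _ /(_ _ n2) Yw] [[sw bw] /= h].
  split => //; rewrite bw (sE _ _ X1 sw) in Yw.
  by move: Yw; rewrite ler_norml => /andP[+ _]; rewrite /=; lra.
Unshelve. all: by end_near. Qed.

End elephant_walk.

Theorem theorem6p2 (d : measure_display) (T : measurableType d) (R : realType)
    (P : probability T R) (p : R) (X : nat -> {RV P >-> R})
    (p01 : 0 < p < 1)
    (X1_pos : P [set w | X 1%N w = 1] = p%:E)
    (X1_neg : P [set w | X 1%N w = -1] = (1 - p)%:E)
    (walk : elephant_walk_first_two p X) :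
  [/\ cvg_in_distribution
        (fun n => (Num.sqrt n%:R)^-1 \o* centered_position p X n : {RV P >-> R})
        (fun x => p%:E * normal_cdf (4 * p * (1 - p)) x
                  + (1 - p)%:E * normal_cdf 1 x)%E,
      {ae P, forall w,
        centered_position p X n w / n%:R @[n --> \oo] --> (0 : R)} &
      {ae P, forall w,
        limn_esup (fun n => (centered_position p X n w
          / Num.sqrt (2 * n%:R * ln (ln n%:R)))%:E)
        = (limit_deviation p X w)%:E /\
        limn_einf (fun n => (centered_position p X n w
          / Num.sqrt (2 * n%:R * ln (ln n%:R)))%:E)
        = (- limit_deviation p X w)%:E}].
Proof.
move: walk => [B [K [B_law K_law indep X2E XnE]]]; split.
- exact: (clt_centered_position p01 X1_pos X1_neg B_law K_law indep X2E XnE).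
- exact: (lln_centered_position p01 X1_pos X1_neg B_law K_law indep X2E XnE).
- exact: (lil_centered_position p01 X1_pos X1_neg B_law K_law indep X2E XnE).
Qed.
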